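(* Let $d\to\infty$ and let $n=n(d)\geq d$ be an integer-valued function of $d$ such that the limit $$\gamma:=\lim_{d\to\infty}\frac{\log(n(d))}{d}\in[0,\infty]$$ exists. For each $d$ let $C_n^B\subseteq\mathbb{R}^d$ be the positive hull of a random walk with $n=n(d)$ steps in $\mathbb{R}^d$, as defined in the context. Then, for every fixed $k\in\mathbb{N}_0$, we have $$\lim_{d\to\infty}\frac{\mathbb{E}\bigl[f_k(C_n^B)\bigr]}{\binom nk}=\begin{cases}1,&\text{if }\gamma<\frac{1}{k+\frac12},\\[2pt]0,&\text{if }\gamma>\frac{1}{k+\frac12}.\end{cases}$$ In the critical case $\gamma=\frac{1}{k+\frac12}$, if $$\log(n(d))=\frac{1}{k+\frac12}\bigl(d+c\sqrt d+o(\sqrt d)\bigr)$$ for some constant $c\in\mathbb{R}$, then $$\lim_{d\to\infty}\frac{\mathbb{E}\bigl[f_k(C_n^B)\bigr]}{\binom nk}=\frac{1}{\sqrt{2\pi}}\int_{-\infty}^{-c}e^{-x^2/2}\,dx.$$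
   Context: $\mathbb{N}_0=\{0,1,2,\ldots\}$. For given $d$ and $n\ge d$, let $\xi_1,\ldots,\xi_n$ be i.i.d. random vectors in $\mathbb{R}^d$ whose distribution is absolutely continuous (with respect to Lebesgue measure) and centrally symmetric (i.e. $\xi_1$ and $-\xi_1$ have the same law). Put $S_i=\xi_1+\cdots+\xi_i$ for $1\le i\le n$. The random polyhedral cone $C_n^B$ is $$C_n^B=\mathrm{pos}\{S_1,\ldots,S_n\}=\{\lambda_1S_1+\cdots+\lambda_nS_n:\lambda_1,\ldots,\lambda_n\geq0\}\subseteq\mathbb{R}^d.$$ For a polyhedral cone $C$, $f_k(C)$ denotes the number of $k$-dimensional faces of $C$. In particular, if $C=\mathbb{R}^d$, then the only face is $C$ itself, so $f_k(C)=0$ for $k<d$; if $C$ is pointed, then $\{0\}$ is its unique $0$-dimensional face. The following known formula may be used as a given: for all $k\in\{0,\ldots,d-1\}$ and $n\geq d$, $$\mathbb{E}[f_k(C_n^B)]=\frac{2\cdot k!}{n!}\sum_{l=0}^\infty\genfrac{[}{]}{0pt}{}{n}{d-2l-1}_{1/2}\genfrac{\{}{\}}{0pt}{}{d-2l-1}{k}_{1/2}.$$ Here, with $\genfrac{[}{]}{0pt}{}{n}{k}$, $\genfrac{\{}{\}}{0pt}{}{n}{k}$ the unsigned Stirling numbers of the first and second kind, the $r$-Stirling numbers for real $r$ are $\genfrac{[}{]}{0pt}{}{n}{k}_r=\sum_{j=k}^n\genfrac{[}{]}{0pt}{}{n}{j}\binom jk r^{j-k}$ and $\genfrac{\{}{\}}{0pt}{}{n}{k}_r=\sum_{j=k}^n\binom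 nj\genfrac{\{}{\}}{0pt}{}{j}{k}r^{n-j}$ for $0\le k\le n$; they are $0$ for $k<0$ or $k>n$, and terms with a negative upper or lower index $d-2l-1$ are $0$. *)

(* Defs.v *)
From HB Require Import structures.
From mathcomp Require Import all_boot all_order all_algebra finmap.
From mathcomp Require Import all_classical all_reals all_analysis.

Set Implicit Arguments.
Unset Strict Implicit.
Unset Printing Implicit Defensive.

Import Order.TTheory GRing.Theory Num.Theory.
Import numFieldNormedType.Exports.

Local Open Scope classical_set_scope.
Local Open Scope ring_scope.

Fixpoint stirling1 (n k : nat) : nat :=
  match n, k with
  | 0, 0 => 1
  | 0, _.+1 | _.+1, 0 => 0
  | n'.+1, k'.+1 => n' * stirling1 n' k'.+1 + stirling1 n' k'
  end%N.

Fixpoint stirling2 (n k : nat) : nat :=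
  match n, k with
  | 0, 0 => 1
  | 0, _.+1 | _.+1, 0 => 0
  | n'.+1, k'.+1 => k'.+1 * stirling2 n' k'.+1 + stirling2 n' k'
  end%N.

Definition rstirling1 (R : realType) (r : R) (n k : nat) : R :=
  \sum_(k <= j < n.+1) (stirling1 n j)%:R * 'C(j, k)%:R * r ^+ (j - k).

Definition rstirling2 (R : realType) (r : R) (n k : nat) : R :=
  \sum_(k <= j < n.+1) 'C(n, j)%:R * (stirling2 j k)%:R * r ^+ (n - j).

Definition pos_hull (R : realType) (d n : nat) (v : 'I_n -> 'rV[R]_d) :
    set 'rV[R]_d :=
  [set x | exists2 a : 'I_n -> R,
     (forall i, 0 <= a i) & x = \sum_(i < n) a i *: v i].

(* Intersections of C with a supporting hyperplane u^_|_; the choice u = 0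
   makes C a face of itself. *)
Definition cone_face (R : realType) (d : nat) (C F : set 'rV[R]_d) : Prop :=
  exists2 u : 'rV[R]_d, (forall x, C x -> (u *m x^T) 0 0 <= 0) &
    F = [set x | C x /\ (u *m x^T) 0 0 = 0].

Definition linear_hull (R : realType) (d : nat) (F : set 'rV[R]_d)
    (U : {vspace 'rV[R]_d}) : Prop :=
  F `<=` [set x | x \in U] /\
  forall W : {vspace 'rV[R]_d}, F `<=` [set x | x \in W] -> (U <= W)%VS.

Definition faces (R : realType) (d : nat) (C : set 'rV[R]_d) (k : nat) :
    set (set 'rV[R]_d) :=
  [set F | cone_face C F /\ exists2 U, linear_hull F U & \dim U = k].

(* fset_set sends an infinite set to fset0, but a polyhedral cone has only
   finitely many faces. *)
Definition face_number (R : realType) (d : nat) (C : set 'rV[R]_d) (k : nat) :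
    nat :=
  #|` fset_set (faces C k)|.

(* Lebesgue measure on R^d as an iterated integral, as in product_measure1. *)
Fixpoint lebesgue_tuple (R : realType) (d : nat) :
    set (d.-tuple R) -> \bar R :=
  match d with
  | 0 => fun A => \d_([tuple] : 0.-tuple R) A
  | d'.+1 => fun A =>
      (\int[lebesgue_measure]_x
         lebesgue_tuple [set t : d'.-tuple R | A [tuple of x :: t]])%E
  end.

Definition mutually_independent (disp dispT : measure_display)
    (Omega : measurableType disp) (T : measurableType dispT) (R : realType)
    (P : probability Omega R) (n : nat) (X : 'I_n -> {RV P >-> T}) : Prop :=
  forall (J : {set 'I_n}) (A : 'I_n -> set T),
    (forall i, measurable (A i)) ->
    P (\bigcap_(i in [set i | i \in J]) (X i @^-1` A i)) =
    (\prod_(i in J) P (X i @^-1` A i))%E.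

Definition identically_distributed (disp dispT : measure_display)
    (Omega : measurableType disp) (T : measurableType dispT) (R : realType)
    (P : probability Omega R) (n : nat) (X : 'I_n -> {RV P >-> T}) : Prop :=
  forall (i j : 'I_n) (A : set T), measurable A ->
    distribution P (X i) A = distribution P (X j) A.

Definition centrally_symmetric (disp : measure_display)
    (Omega : measurableType disp) (R : realType)
    (P : probability Omega R) (d : nat) (X : {RV P >-> d.-tuple R}) : Prop :=
  forall A : set (d.-tuple R), measurable A ->
    P [set w | A (X w)] = P [set w | A [tuple - tnth (X w) j | j < d]].

Definition walk_steps (disp : measure_display)
    (Omega : measurableType disp) (R : realType)
    (P : probability Omega R) (d n : nat)
    (xi : 'I_n -> {RV P >-> d.-tuple R}) : Prop :=
  [/\ mutually_independent xi,
      identically_distributed xi,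
      forall i, distribution P (xi i) `<< @lebesgue_tuple R d &
      forall i, centrally_symmetric (xi i)].

Definition walk (disp : measure_display)
    (Omega : measurableType disp) (R : realType)
    (P : probability Omega R) (d n : nat)
    (xi : 'I_n -> {RV P >-> d.-tuple R}) (w : Omega) (i : 'I_n) : 'rV[R]_d :=
  \sum_(j < n | (j <= i)%N) \row_l tnth (xi j w) l.

Definition walk_cone (disp : measure_display)
    (Omega : measurableType disp) (R : realType)
    (P : probability Omega R) (d n : nat)
    (xi : 'I_n -> {RV P >-> d.-tuple R}) (w : Omega) : set 'rV[R]_d :=
  pos_hull (walk xi w).

Definition expected_faces (disp : measure_display)
    (Omega : measurableType disp) (R : realType)
    (P : probability Omega R) (d n : nat)
    (xi : 'I_n -> {RV P >-> d.-tuple R}) (k : nat) : \bar R :=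
  'E_P[fun w => (face_number (walk_cone xi w) k)%:R].

(* The known formula for the expected face numbers, used as a given. The sum
   runs over the l with d - 2l - 1 >= 0, the remaining terms being 0. *)
Definition expected_faces_formula (R : realType) : Prop :=
  forall (disp : measure_display) (Omega : measurableType disp)
    (P : probability Omega R) (d n k : nat)
    (xi : 'I_n -> {RV P >-> d.-tuple R}),
    (d <= n)%N -> (k < d)%N -> walk_steps xi ->
    expected_faces xi k =
    (2 * k`!%:R / n`!%:R *
     \sum_(l < d | (l.*2 < d)%N)
       rstirling1 2^-1 n (d - l.*2 - 1) * rstirling2 2^-1 (d - l.*2 - 1) k)%:E.

(* Main.v *)
Require Import Defs.
From HB Require Import structures.
From mathcomp Require Import all_boot all_order all_algebra finmap.
From mathcomp Require Import all_classical all_reals all_analysis.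
From mathcomp Require Import measurable_realfun ring lra.

(* Expanding the 1/2-Stirling numbers of the second kind as alternating sums of
   powers turns the formula for the expected face number into
     sum_j (-1)^(k-j) C(k,j) C(n+j,j) * 2 P(Y_j = d-1, d-3, ...),
   where Y_j is a sum of n independent Bernoulli variables with success
   probabilities (j+1/2)/(j+1+i), i < n.  The variable with i = j is a fair
   coin, and splitting it off removes the parity restriction:
     2 P(Y_j = d-1, d-3, ...) = P(Y_j' < d),
   where Y_j' is the sum of the remaining variables.  Since
   C(n+j,j)/C(n,k) -> [j = k], only P(Y_k' < d) survives in the limit.  Mean and
   variance of Y_k' are (k+1/2) log n + O(1), so Chebyshev's inequality settles
   the two non-critical cases.  In the critical case a central limit theorem is
   needed; it is proved by Lindeberg's replacement method, applied directly to
   the explicit solution Phi((a-x)/sqrt(s)) of the heat equation. *)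

Set Implicit Arguments.
Unset Strict Implicit.
Unset Printing Implicit Defensive.

Import Order.TTheory GRing.Theory Num.Theory.
Import numFieldNormedType.Exports.

Local Open Scope classical_set_scope.
Local Open Scope ring_scope.

(** * Stirling numbers *)

Lemma stirling2_small (n k : nat) : (n < k)%N -> stirling2 n k = 0%N.
Proof.
elim: n k => [|n IHn] [|k] //= nk.
by rewrite !IHn ?muln0 // ltnW.
Qed.

Lemma stirling1_small (n k : nat) : (n < k)%N -> stirling1 n k = 0%N.
Proof.
elim: n k => [|n IHn] [|k] //= nk.
by rewrite !IHn ?muln0 // ltnW.
Qed.

Lemma big_nat_widen_zero (V : nmodType) (F : nat -> V) (k m : nat) :
  (forall i, (i < k)%N -> F i = 0) -> \sum_(k <= i < m) F i = \sum_(i < m) F i.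
Proof.
move=> F0; rewrite -(big_mkord xpredT F).
have [km|mk] := leqP k m.
  rewrite [RHS](big_cat_nat (n := k)) //= [X in _ = X + _]big_nat.
  by rewrite [X in _ = X + _]big1 ?add0r // => i /andP[_ /F0].
rewrite [LHS]big_geq ?(ltnW mk)// big_mkord [RHS]big1 // => -[i im] _ /=.
by rewrite F0 // (ltn_trans im).
Qed.

(** Inclusion-exclusion count of the surjections from an [i]-set onto a [k]-set. In the induction on
    [i], absorption [j C(k,j) = k C(k-1,j-1)] followed by Pascal's rule turns the alternating sum
    into the recurrence of [k! * stirling2 i k]. *)
Lemma fact_stirling2 (R : comPzRingType) (i k : nat) :
  (k`! * stirling2 i k)%:R =
  \sum_(j < k.+1) (-1) ^+ (k - j) *+ 'C(k, j) * j%:R ^+ i :> R.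
Proof.
elim: i k => [|i IHi] k.
  under eq_bigr do rewrite expr0 mulr1.
  have := exprDn (-1 : R) 1 k.
  under [in RHS]eq_bigr do rewrite expr1n mulr1.
  move=> <-; rewrite addrC subrr.
  by case: k => [|k] /=; rewrite ?muln0 // expr0n.
case: k => [|k]; first by rewrite muln0 big_ord1 expr0n mulr0.
rewrite big_ord_recl expr0n mulr0 add0r.
have step (j : nat) : (-1) ^+ (k.+1 - j.+1) *+ 'C(k.+1, j.+1) * j.+1%:R ^+ i.+1 =
    k.+1%:R * ((-1) ^+ (k.+1 - j.+1) *+ 'C(k.+1, j.+1) * j.+1%:R ^+ i
               - (-1) ^+ (k.+1 - j.+1) *+ 'C(k, j.+1) * j.+1%:R ^+ i) :> R.
  rewrite subSS exprS -!(mulr_natr (_ ^+ (k - j))).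
  have -> : 'C(k, j.+1)%:R = 'C(k.+1, j.+1)%:R - 'C(k, j)%:R :> R.
    by rewrite binS natrD addrK.
  have := mul_bin_diag k.+1 j => /(congr1 (fun m => m%:R : R)).
  rewrite !natrM /= => e.
  transitivity ((-1) ^+ (k - j) * j.+1%:R ^+ i * (j.+1%:R * 'C(k.+1, j.+1)%:R) : R).
    by ring.
  by rewrite -e; ring.
under eq_bigr do rewrite !lift0 step.
rewrite -big_distrr /= sumrB.
have := IHi k.+1; rewrite big_ord_recl.
under [X in (_ = _ + X) -> _]eq_bigr do rewrite !lift0.
move=> IH1.
have IH0 := IHi k.
have -> : \sum_(j < k.+1) (-1) ^+ (k.+1 - j.+1) *+ 'C(k, j.+1) * j.+1%:R ^+ i =
   \sum_(j < k.+2) (-1) ^+ (k.+1 - j) *+ 'C(k, j) * j%:R ^+ i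
    - (-1) ^+ k.+1 * 0 ^+ i :> R.
  by rewrite [in RHS]big_ord_recl /= bin0 subn0 mulr1n [X in X - _]addrC addrK.
rewrite [X in _ = _ * (_ - (X - _))]big_ord_recr /=.
rewrite (@bin_small k k.+1) // mulr0n mul0r addr0.
have -> : \sum_(j < k.+1) (-1) ^+ (k.+1 - j) *+ 'C(k, j) * j%:R ^+ i =
   - (k`! * stirling2 i k)%:R :> R.
  rewrite IH0 -sumrN; apply: eq_bigr => j _.
  by rewrite subSn ?leq_ord // exprS mulN1r mulNrn mulNr.
move: IH1; rewrite bin0 subn0 mulr1n => IH1.
move: IH1 => /(congr1 (fun z => - ((-1) ^+ k.+1 * 0 ^+ i) + z)).
rewrite addKr => <-.
by rewrite factS !(natrM, natrD); ring.
Qed.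

(** After inserting the alternating sum and exchanging the summations, the inner sum is the binomial
    expansion of [(j + r) ^+ m]. *)
Lemma rstirling2_formula (R : realType) (r : R) (m k : nat) :
  k`!%:R * rstirling2 r m k =
  \sum_(j < k.+1) (-1) ^+ (k - j) *+ 'C(k, j) * (j%:R + r) ^+ m.
Proof.
have -> : rstirling2 r m k =
    \sum_(i < m.+1) 'C(m, i)%:R * (stirling2 i k)%:R * r ^+ (m - i).
  by apply: big_nat_widen_zero => i ik; rewrite stirling2_small // mulr0 mul0r.
rewrite big_distrr /=.
under eq_bigr => i _.
  rewrite -mulrA mulrCA [X in _ * X]mulrA -natrM fact_stirling2.
  rewrite big_distrl big_distrr /=.
  over.
rewrite exchange_big /=; apply: eq_bigr => j _.
rewrite addrC exprDn big_distrr /=; apply: eq_bigr => i _.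
by rewrite -[_ *+ 'C(m, i)]mulr_natr; ring.
Qed.

Lemma rising_factorial_stirling1 (R : comNzRingType) (n : nat) :
  \prod_(i < n) ('X + i%:R%:P) = \poly_(j < n.+1) (stirling1 n j)%:R :> {poly R}.
Proof.
elim: n => [|n IHn].
  by rewrite big_ord0 poly_def big_ord1 scale1r expr0.
rewrite big_ord_recr /= IHn; apply/polyP => j.
rewrite mulrDr coefD coefMC coefMX !coef_poly.
case: j => [|j] /=.
  by rewrite add0r; case: n {IHn} => [|n] /=; rewrite ?mulr0 ?mul0r.
rewrite !ltnS natrD natrM.
have [jn|nj|<-] := ltngtP j n.
- by rewrite mulrC addrC.
- by rewrite mul0r addr0.
- by rewrite (@stirling1_small j j.+1) // mul0r mulr0 addr0 add0r.
Qed.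

(** Substituting [X + r] for [X] in the rising factorial and expanding each power binomially gives
    the defining sum. *)
Lemma rstirling1_gen (R : realType) (r : R) (n m : nat) :
  rstirling1 r n m = (\prod_(i < n) ('X + (i%:R + r)%:P))`_m.
Proof.
have -> : \prod_(i < n) ('X + (i%:R + r)%:P) =
    (\prod_(i < n) ('X + i%:R%:P)) \Po ('X + r%:P) :> {poly R}.
  rewrite rmorph_prod /=; apply: eq_bigr => i _.
  by rewrite comp_polyD comp_polyX comp_polyC polyCD addrA addrAC.
rewrite rising_factorial_stirling1 poly_def raddf_sum coef_sum /=.
under eq_bigr => j _.
  rewrite comp_polyZ comp_Xn_poly coefZ addrC exprDn coef_sum.
  under eq_bigr do rewrite -polyC_exp coefMn coefCM coefXn.
  over.
have FE (j : nat) : (\sum_(i < j.+1) (r ^+ (j - i) * (m == i)%:R) *+ 'C(j, i)) =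
    r ^+ (j - m) * 'C(j,m)%:R.
  have [mj|jm] := ltnP m j.+1.
    rewrite (bigD1 (Ordinal mj)) //= eqxx mulr1 mulr_natr big1 ?addr0// => i.
    by rewrite -val_eqE eq_sym /= => /negbTE ->; rewrite mulr0 mul0rn.
  rewrite bin_small // mulr0 big1 // => i _.
  by rewrite gtn_eqF ?mulr0 ?mul0rn // (leq_trans (ltn_ord i)).
under [RHS]eq_bigr do rewrite FE [r ^+ _ * _]mulrC mulrA.
apply: big_nat_widen_zero => i im.
by rewrite bin_small // mulr0 mul0r.
Qed.

(** * Reduction to a sum of Bernoulli variables *)

(* The mean of [f (x + Y)], where [Y] is a sum of independent Bernoulli
   variables whose success probabilities are listed in [s]. *)
Fixpoint bernoulli_mean (R : pzRingType) (s : seq R) (f : R -> R) (x : R) : R :=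
  if s is p :: s' then
    p * bernoulli_mean s' f (x + 1) + (1 - p) * bernoulli_mean s' f x
  else f x.

(** The product is the generating function of the Bernoulli sum, so its coefficients are the point
    weights. *)
Lemma bernoulli_mean_coef (R : comNzRingType) (s : seq R) (f : R -> R) (x : R)
    (N : nat) : (size s < N)%N ->
  bernoulli_mean s f x =
  \sum_(m < N) (\prod_(p <- s) (p *: 'X + (1 - p)%:P))`_m * f (x + m%:R).
Proof.
elim: s x N => [|p s IHs] x N /=.
  case: N => // N _; rewrite big_nil big_ord_recl big1 ?addr0.
    by rewrite coefC mul1r.
  by move=> i _; rewrite coefC /= mul0r.
case: N => // N; rewrite ltnS => sN.
rewrite (IHs (x + 1) N) // (IHs x N.+1) ?ltnS ?(ltnW sN)// big_cons.
under [RHS]eq_bigr do rewrite mulrDl coefD coefCM -scalerAl coefZ coefXM mulrDl.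
rewrite [RHS]big_split /= [X in _ = X + _]big_ord_recl /= mulr0 mul0r add0r.
congr (_ + _); rewrite big_distrr /=.
  by apply: eq_bigr => i _; rewrite add0n mulrA /bump leq0n natrD addrA.
by apply: eq_bigr => i _; rewrite mulrA.
Qed.

(** Each coefficient of [(X + 1) * q] adds two neighbouring coefficients of [q], so the indices
    [d - 1], [d - 3], ... collect every coefficient of [q] below [d] exactly once. *)
Lemma coef_sum_parity (R : comNzRingType) (q : {poly R}) (d N : nat) :
  (d <= N)%N ->
  \sum_(l < N | (l.*2 < d)%N) (('X + 1) * q)`_(d - l.*2 - 1) =
  \sum_(m < d) q`_m.
Proof.
have coefE m : (('X + 1) * q)`_m.+1 = q`_m + q`_m.+1.
  by rewrite mulrDl mul1r coefD coefXM.
(* The induction lowers [d] by two but [N] by one, which is why the range of [l] is decoupled from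
   [d]. *)
have [b] := ubnP d; elim: b d N => // b IHb [|[|d]] N.
- by move=> _ _; rewrite big_ord0 big_pred0.
- case: N => // N _ _; rewrite big_ord1 big_mkcond big_ord_recl /= big1 ?addr0.
    by rewrite mulrDl mul1r coefD coefXM /= add0r.
  by [].
case: N => // N db dN; rewrite big_mkcond big_ord_recl /=.
rewrite double0 subn0 subn1 /= coefE !big_ord_recr /= addrC -addrA; congr (_ + _).
rewrite -(IHb d N);
  [|exact: ltnW|by rewrite -ltnS ltnW].
rewrite [RHS]big_mkcond; apply: eq_bigr => l _.
by rewrite /bump leq0n add1n doubleS !ltnS !subSS.
Qed.

Lemma coef_comp_scaleX (R : comNzRingType) (q : {poly R}) (c : R) (m : nat) :
  (q \Po (c *: 'X))`_m = c ^+ m * q`_m.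
Proof.
have -> : q \Po (c *: 'X) = \poly_(i < size q) (c ^+ i * q`_i).
  rewrite comp_polyE poly_def; apply: eq_bigr => i _.
  by rewrite exprZn scalerA mulrC.
rewrite coef_poly; case: ltnP => // qm.
by rewrite nth_default // mulr0.
Qed.

(** The weight of [X] once the factor [(j + 1/2) X + (i + 1/2)] is divided by its value [j + 1 + i]
    at [X = 1]. *)
Definition step_prob (R : realType) (j i : nat) : R :=
  (j%:R + 2^-1) / (j%:R + 1 + i%:R).

(* The index [i = j], where the success probability is 1/2, is left out. *)
Definition step_probs (R : realType) (j n : nat) : seq R :=
  [seq step_prob R j i | i <- index_iota 0 n & i != j].

Definition below_prob (R : realType) (j n d : nat) : R :=
  bernoulli_mean (step_probs R j n) (fun w => ((w < d%:R)%R)%:R) 0.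

Lemma below_prob_coef (R : realType) (j n d : nat) :
  below_prob R j n d =
  \sum_(m < d) (\prod_(p <- step_probs R j n) (p *: 'X + (1 - p)%:P))`_m.
Proof.
rewrite /below_prob (@bernoulli_mean_coef _ _ _ _ (d + (size (step_probs R j n)).+1)).
  rewrite big_split_ord /= [X in _ + X]big1 ?addr0; last first.
    by move=> i _; rewrite add0r ltr_nat ltnNge leq_addr mulr0.
  by apply: eq_bigr => i _; rewrite add0r ltr_nat ltn_ord mulr1.
by rewrite addnS ltnS leq_addl.
Qed.

(** Dividing each factor by its value at 1 makes it a Bernoulli generating function. The divisors
    multiply to [(n + j)! / j!], and the factor [i = j], present because [j < n], becomes
    [(X + 1) / 2]. *)
Lemma rising_product_half (R : realType) (j n : nat) : (j < n)%N ->
  \prod_(i < n) ((j%:R + 2^-1) *: 'X + (i%:R + 2^-1)%:P) =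
  ((n + j)`!%:R / j`!%:R / 2) *:
    (('X + 1) * \prod_(p <- step_probs R j n) (p *: 'X + (1 - p)%:P)) :> {poly R}.
Proof.
move=> jn.
have pos i : j%:R + 1 + i%:R != 0 :> R by rewrite natr1 -natrD pnatr_eq0.
under [LHS]eq_bigr => i _.
  have -> : (j%:R + 2^-1) *: 'X + (i%:R + 2^-1)%:P =
     (j%:R + 1 + i%:R) *: (step_prob R j i *: 'X + (1 - step_prob R j i)%:P).
    rewrite scalerDr scalerA -mul_polyC -[X in _ = _ + X]mul_polyC -polyCM mul_polyC.
    by congr (_ *: _ + _%:P); rewrite /step_prob; have := pos i => ?; field.
  over.
rewrite scaler_prod.
have -> : \prod_(i < n) (j%:R + 1 + i%:R) = (n + j)`!%:R / j`!%:R :> R.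
  apply: (canRL (mulfK _)); first by rewrite pnatr_eq0 -lt0n fact_gt0.
  elim: n {jn} => [|n IHn]; first by rewrite big_ord0 mul1r.
  rewrite big_ord_recr /= mulrAC IHn addSn factS natrM mulrC natr1 -natrD.
  by rewrite addSn addnC.
rewrite -[RHS]scalerA; congr (_ *: _).
rewrite /step_probs big_map big_filter.
rewrite big_mkord (bigD1 (Ordinal jn)) //= scalerAl; congr (_ * _).
have -> : step_prob R j j = 2^-1.
  by rewrite /step_prob; have := pos j => ?; field.
have -> : 1 - 2^-1 = 2^-1 :> R by field.
by rewrite scalerDr -[2^-1 *: 1]/(2^-1%:A) alg_polyC.
Qed.

Lemma expected_faces_below (R : realType) (n d k : nat) : (k < n)%N ->
  2 * k`!%:R / n`!%:R * (\sum_(l < d | (l.*2 < d)%N)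
    rstirling1 2^-1 n (d - l.*2 - 1) * rstirling2 2^-1 (d - l.*2 - 1) k) =
  \sum_(j < k.+1) (-1) ^+ (k - j) *+ 'C(k, j) * 'C(n + j, j)%:R
                    * below_prob R j n d.
Proof.
move=> kn.
have -> : 2 * k`!%:R / n`!%:R * (\sum_(l < d | (l.*2 < d)%N)
    rstirling1 2^-1 n (d - l.*2 - 1) * rstirling2 2^-1 (d - l.*2 - 1) k) =
  2 / n`!%:R * (\sum_(l < d | (l.*2 < d)%N) \sum_(j < k.+1)
    (-1) ^+ (k - j) *+ 'C(k, j) * ((j%:R + 2^-1) ^+ (d - l.*2 - 1)
      * rstirling1 2^-1 n (d - l.*2 - 1))) :> R.
  rewrite [2 * _ / _]mulrAC -[LHS]mulrA; congr (_ * _).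
  rewrite mulr_sumr; apply: eq_bigr => l _ /=.
  rewrite mulrCA rstirling2_formula mulr_sumr; apply: eq_bigr => j _ /=.
  by rewrite mulrCA; congr (_ * _); rewrite mulrC.
rewrite exchange_big mulr_sumr; apply: eq_bigr => j _ /=.
rewrite -mulr_sumr mulrCA -[RHS]mulrA; congr (_ * _).
have jn : (j < n)%N by rewrite (leq_trans (ltn_ord j)).
(* The power of [j + 1/2] beside each coefficient amounts to substituting [(j + 1/2) X] for [X]. *)
under eq_bigr do rewrite rstirling1_gen -coef_comp_scaleX.
have -> : (\prod_(i < n) ('X + (i%:R + 2^-1)%:P)) \Po ((j%:R + 2^-1) *: 'X) =
    \prod_(i < n) ((j%:R + 2^-1) *: 'X + (i%:R + 2^-1)%:P) :> {poly R}.
  rewrite rmorph_prod /=; apply: eq_bigr => i _.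
  by rewrite comp_polyD comp_polyX comp_polyC.
rewrite rising_product_half //.
under eq_bigr do rewrite coefZ.
rewrite -mulr_sumr coef_sum_parity // -below_prob_coef mulrA; congr (_ * _).
(* [(n + j)! / (j! n!)] is the binomial coefficient, and the leading 2 cancels the 1/2 of the fair
   coin. *)
have := bin_fact (leq_addl n j); rewrite addnK => /(congr1 (fun m => m%:R : R)).
rewrite !natrM => <-.
have nz m : m`!%:R != 0 :> R by rewrite pnatr_eq0 -lt0n fact_gt0.
by field; rewrite !nz.
Qed.

(** * Moments of the Bernoulli sum *)

Lemma bernoulli_mean_affine (R : comPzRingType) (s : seq R) (f : R -> R)
    (a b x : R) :
  bernoulli_mean s (fun w => a * f w + b) x = a * bernoulli_mean s f x + b.
Proof. by elim: s x => //= p s IHs x; rewrite !IHs; ring. Qed.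

(** Squared bias plus variance. *)
Lemma bernoulli_mean_sqr (R : comPzRingType) (s : seq R) (c x : R) :
  bernoulli_mean s (fun w => (w - c) ^+ 2) x =
  (x + \sum_(p <- s) p - c) ^+ 2 + \sum_(p <- s) p * (1 - p).
Proof.
elim: s x => [|p s IHs] x /=; first by rewrite !big_nil !addr0.
by rewrite !big_cons !IHs; ring.
Qed.

Lemma bernoulli_mean_le (R : realDomainType) (s : seq R) (f g : R -> R) (x : R) :
  {in s, forall p, 0 <= p <= 1} -> (forall w, f w <= g w) ->
  bernoulli_mean s f x <= bernoulli_mean s g x.
Proof.
move=> + fg; elim: s x => //= p s IHs x s01.
have /andP[p0 p1] := s01 p (mem_head p s).
have {}IHs y : bernoulli_mean s f y <= bernoulli_mean s g y.
  by apply: IHs => q qs; apply: s01; rewrite inE qs orbT.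
by rewrite lerD // ler_wpM2l // subr_ge0.
Qed.

(** Chebyshev's inequality for any [f] below a parabola centred at the mean, so that it serves both
    an indicator and its complement. *)
Lemma bernoulli_chebyshev (R : realFieldType) (s : seq R) (f : R -> R) (t : R) :
  {in s, forall p, 0 <= p <= 1} ->
  (forall w, f w <= (w - \sum_(p <- s) p) ^+ 2 / t ^+ 2) ->
  bernoulli_mean s f 0 <= (\sum_(p <- s) p * (1 - p)) / t ^+ 2.
Proof.
move=> s01 ft; apply: le_trans (bernoulli_mean_le (g := fun w =>
  t ^- 2 * (w - \sum_(p <- s) p) ^+ 2 + 0) 0 s01 _) _.
  by move=> w; rewrite addr0 mulrC; exact: ft.
rewrite bernoulli_mean_affine bernoulli_mean_sqr add0r subrr expr0n add0r addr0.
by rewrite mulrC.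
Qed.

(** Both bounds are instances of [ln (1 + u) <= u], at [u = - 1 / (x + 1)] and at [u = 1 / x]. *)
Lemma ln_succ_bounds (R : realType) (x : R) : 0 < x ->
  (x + 1)^-1 <= ln (x + 1) - ln x <= x^-1.
Proof.
move=> x0; have x10 : 0 < x + 1 by rewrite addr_gt0.
rewrite -ln_div ?posrE //; apply/andP; split.
  rewrite -lerN2 -lnV ?posrE ?divr_gt0 // invf_div.
  have -> : x / (x + 1) = 1 + - (x + 1)^-1 by field; rewrite gt_eqF.
  by rewrite le_ln1Dx // ltrN2 invf_lt1 // ltrDr.
have -> : (x + 1) / x = 1 + x^-1 by field; rewrite gt_eqF.
by rewrite le_ln1Dx // (lt_trans (ltrN10 R)) // invr_gt0.
Qed.

Lemma shifted_harmonic_le (R : realType) (k n : nat) : (0 < n)%N ->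
  \sum_(i < n) (k%:R + 1 + i%:R)^-1 <= 1 + ln n%:R :> R.
Proof.
elim: n => // -[|n] IHn _.
  by rewrite big_ord1 addr0 ln1 addr0 natr1 invf_le1 ?ltr0n // ler1n.
rewrite big_ord_recr /=; have := IHn isT.
have /andP[+ _] := @ln_succ_bounds R n.+1%:R (ltr0Sn _ _).
rewrite [n.+1%:R + 1]natr1; have : (k%:R + 1 + n.+1%:R)^-1 <= n.+2%:R^-1 :> R.
  by rewrite natr1 -natrD lef_pV2 ?posrE ?ltr0n // ler_nat addSn ltnS leq_addl.
set a := (k%:R + 1 + n.+1%:R)^-1; set b := n.+2%:R^-1.
set c := \sum_(i < n.+1) _; move: a b c => a b c; lra.
Qed.

Lemma shifted_harmonic_ge (R : realType) (k n : nat) :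
  ln (k%:R + 1 + n%:R) - ln (k%:R + 1) <= \sum_(i < n) (k%:R + 1 + i%:R)^-1 :> R.
Proof.
elim: n => [|n IHn]; first by rewrite big_ord0 addr0 subrr.
rewrite big_ord_recr /= -natr1 addrA; move: IHn.
have a0 : 0 < k%:R + 1 + n%:R :> R by rewrite natr1 -natrD ltr0n addSn.
have /andP[_] := ln_succ_bounds a0.
lra.
Qed.

(** Telescoping with [1 / (n + 1)^2 <= 1 / n - 1 / (n + 1)]. *)
Lemma shifted_inv_squares_le (R : realType) (k n : nat) : (0 < n)%N ->
  \sum_(i < n) (k%:R + 1 + i%:R) ^- 2 <= 2 - n%:R^-1 :> R.
Proof.
elim: n => // -[|n] IHn _.
  rewrite big_ord1 addr0 invr1 natr1 -exprVn.
  have -> : 2 - 1 = 1 :> R by lra.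
  by rewrite expr_le1 ?invr_ge0 // invf_le1 ?ltr0n // ler1n.
rewrite big_ord_recr /=; have := IHn isT.
have : (k%:R + 1 + n.+1%:R) ^- 2 <= n.+2%:R ^- 2 :> R.
  rewrite lef_pV2 ?posrE ?exprn_gt0 ?ltr0n // ?natr1 -?natrD ?ltr0n ?addSn //.
  by rewrite lerXn2r ?nnegrE // ler_nat ltnS leq_addl.
have : n.+2%:R ^- 2 <= n.+1%:R^-1 - n.+2%:R^-1 :> R.
  have -> : n.+1%:R^-1 - n.+2%:R^-1 = (n.+1%:R * n.+2%:R)^-1 :> R.
    rewrite -[n.+2%:R]natr1; have : 0 < n.+1%:R :> R by rewrite ltr0n.
    by move: n.+1%:R => x x0; field; rewrite !gt_eqF // addr_gt0.
  rewrite lef_pV2 ?posrE ?exprn_gt0 ?mulr_gt0 ?ltr0n // expr2.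
  by rewrite ler_pM2r ?ltr0n // ler_nat.
set a := (k%:R + 1 + n.+1%:R) ^- 2; set b := n.+2%:R^-1; set b' := n.+1%:R^-1.
set c := \sum_(i < n.+1) _; set e := n.+2%:R ^- 2.
move: a b b' c e => a b b' c e; lra.
Qed.

Lemma step_prob01 (R : realType) (k i : nat) : 0 <= step_prob R k i <= 1.
Proof.
have k0 : 0 <= k%:R :> R by [].
have i0 : 0 <= i%:R :> R by [].
rewrite /step_prob divr_ge0 /=; [|lra|lra].
by rewrite ler_pdivrMr; lra.
Qed.

Lemma step_probs01 (R : realType) (k n : nat) :
  {in step_probs R k n, forall p, 0 <= p <= 1}.
Proof. by move=> p /mapP[i _ ->]; exact: step_prob01. Qed.

Lemma sum_step_probs (R : realType) (k n : nat) (f : R -> R) : (k < n)%N ->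
  \sum_(p <- step_probs R k n) f p =
  \sum_(i < n) f (step_prob R k i) - f 2^-1.
Proof.
move=> kn; rewrite /step_probs big_map big_filter big_mkord.
rewrite [in RHS](bigD1 (Ordinal kn)) //=.
have -> : step_prob R k k = 2^-1.
  by rewrite /step_prob; field; rewrite natr1 -natrD pnatr_eq0.
by rewrite addrC addrK; apply: eq_bigl.
Qed.

(** With [kappa = k + 1/2], and up to the omitted entry 1/2, the mean is [kappa h] and the variance
    [kappa h - kappa^2 q], where [h] is a shifted harmonic sum, equal to [ln n + O(1)], and [q <= 2]
    is a sum of inverse squares. *)
Lemma step_probs_moments (R : realType) (k : nat) : exists C : R, forall n : nat,
  (k < n)%N ->
  `|\sum_(p <- step_probs R k n) p - (k%:R + 2^-1) * ln n%:R| <= C /\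
  `|\sum_(p <- step_probs R k n) p * (1 - p) - (k%:R + 2^-1) * ln n%:R| <= C.
Proof.
set kappa : R := k%:R + 2^-1.
(* The final 1 absorbs the omitted entry, which accounts for 1/2 in the mean and 1/4 in the
   variance. *)
exists (kappa * (1 + ln (k%:R + 1)) + 2 * kappa ^+ 2 + 1) => n kn.
have n0 : (0 < n)%N by exact: leq_ltn_trans kn.
have k0 : 0 <= k%:R :> R by [].
have kappa0 : 0 < kappa by rewrite /kappa; lra.
rewrite (sum_step_probs id kn) (sum_step_probs (fun p => p * (1 - p)) kn).
have mean : \sum_(i < n) step_prob R k i =
    kappa * \sum_(i < n) (k%:R + 1 + i%:R)^-1 by rewrite mulr_sumr.
have -> : \sum_(i < n) step_prob R k i * (1 - step_prob R k i) =
    kappa * \sum_(i < n) (k%:R + 1 + i%:R)^-1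
    - kappa ^+ 2 * \sum_(i < n) (k%:R + 1 + i%:R) ^- 2.
  rewrite -mean mulr_sumr -sumrB; apply: eq_bigr => i _.
  by rewrite mulrBr mulr1 -expr2 /step_prob exprMn exprVn.
rewrite mean.
have h_le := shifted_harmonic_le R k n0.
have h_ge : ln n%:R - ln (k%:R + 1) <= \sum_(i < n) (k%:R + 1 + i%:R)^-1 :> R.
  apply: le_trans (shifted_harmonic_ge R k n); rewrite lerD2r ler_ln ?posrE ?ltr0n //.
    by rewrite lerDr addr_ge0.
have sq_le : \sum_(i < n) (k%:R + 1 + i%:R) ^- 2 <= 2 :> R.
  by apply: le_trans (shifted_inv_squares_le R k n0) _; rewrite gerBl invr_ge0.
have sq_ge : 0 <= \sum_(i < n) (k%:R + 1 + i%:R) ^- 2 :> R.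
  by apply: sumr_ge0 => i _; rewrite invr_ge0 exprn_ge0 // !addr_ge0.
have lnk : 0 <= ln (k%:R + 1) :> R by rewrite ln_ge0 // lerDr.
move: h_le h_ge sq_le sq_ge lnk.
set h := \sum_(i < n) _^-1; set q := \sum_(i < n) _ ^- 2.
set L := ln n%:R; set l := ln (k%:R + 1) => h_le h_ge q_le q_ge l_ge.
have h_le' := ler_wpM2l (ltW kappa0) h_le.
have h_ge' := ler_wpM2l (ltW kappa0) h_ge.
have q_le' := ler_wpM2l (sqr_ge0 kappa) q_le.
have q_ge' := mulr_ge0 (sqr_ge0 kappa) q_ge.
have l_ge' := mulr_ge0 (ltW kappa0) l_ge.
split; rewrite ler_norml; apply/andP; split; nra.
Qed.

(** * The normal distribution function *)

Definition gauss_cdf (R : realType) (x : R) : R :=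
  fine (normal_prob 0 1 `]-oo, x]%classic).

Lemma sqrt_2pi_neq0 (R : realType) : Num.sqrt (2 * pi) != 0 :> R.
Proof. by rewrite gt_eqF // sqrtr_gt0 mulr_gt0 // pi_gt0. Qed.

Definition gauss_pdf (R : realType) (x : R) : R :=
  (Num.sqrt (2 * pi))^-1 * expR (- x ^+ 2 / 2).

Lemma normal_pdf01E (R : realType) : normal_pdf 0 1 = @gauss_pdf R.
Proof.
apply/funext => x; rewrite normal_pdfE // /normal_peak /normal_fun /gauss_pdf.
by rewrite subr0 expr1n mul1r -mulr_natl.
Qed.

Lemma gauss_cdfE (R : realType) (x : R) :
  (gauss_cdf x)%:E = (((Num.sqrt (2 * pi))^-1)%:E *
    \int[lebesgue_measure]_(x in `]-oo, x]) (expR (- (x ^+ 2) / 2)%R)%:E)%E.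
Proof.
rewrite /gauss_cdf fineK; last first.
  exact: fin_num_measure.
rewrite -ge0_integralZl //=.
- by rewrite /normal_prob normal_pdf01E; under eq_integral do rewrite EFinM.
- apply/measurable_EFinP; apply: measurable_funTS.
  apply: measurableT_comp => //; apply: measurable_funM => //.
  by apply: measurableT_comp => //; exact: measurable_funX.
Qed.

Lemma gauss_cdf_le (R : realType) (x y : R) :
  x <= y -> gauss_cdf x <= gauss_cdf y.
Proof.
move=> xy; rewrite fine_le ?fin_num_measure //.
by rewrite le_measure ?inE //; exact: subitvPr.
Qed.

Lemma gauss_cdf_ge0 (R : realType) (x : R) : 0 <= gauss_cdf x.
Proof. by rewrite fine_ge0. Qed.

Lemma gauss_cdf_le1 (R : realType) (x : R) : gauss_cdf x <= 1.
Proof.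
rewrite -lee_fin /gauss_cdf fineK ?fin_num_measure //.
exact: probability_le1.
Qed.

(** Under the normal law the identity is a random variable with distribution function [gauss_cdf],
    so the general limits of distribution functions apply. *)
Lemma gauss_cdf_cvgy (R : realType) : gauss_cdf x @[x --> +oo] --> (1 : R).
Proof.
pose X : measurableTypeR R -> R := idfun.
pose mX : isMeasurableFun _ _ _ _ X :=
  isMeasurableFun.Build _ _ _ _ X (@measurable_id _ _ setT).
pose Y : {RV (normal_prob (0 : R) 1) >-> R} := HB.pack_for {mfun _ >-> _} X mX.
exact: (fine_cvg (cvg_cdfy1 (P := normal_prob 0 1) Y)).
Qed.

Lemma gauss_cdf_cvgNy (R : realType) : gauss_cdf x @[x --> -oo] --> (0 : R).
Proof.
pose X : measurableTypeR R -> R := idfun.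
pose mX : isMeasurableFun _ _ _ _ X :=
  isMeasurableFun.Build _ _ _ _ X (@measurable_id _ _ setT).
pose Y : {RV (normal_prob (0 : R) 1) >-> R} := HB.pack_for {mfun _ >-> _} X mX.
exact: (fine_cvg (cvg_cdfNy0 (P := normal_prob 0 1) Y)).
Qed.

Lemma is_derive_gauss_cdf (R : realType) (x : R) :
  is_derive x 1 (@gauss_cdf R) (gauss_pdf x).
Proof.
have [] := @continuous_FTC1 R (normal_pdf 0 1) -oo%O x (x + 1).
- by rewrite ltrDl.
- apply: integrableS (integrable_normal_pdf 0 1) => //.
- by rewrite ltNyr.
- by apply: continuous_normal_pdf.
move=> dF F'E; apply: DeriveDef; first exact: dF.
by rewrite -normal_pdf01E -F'E derive1E.
Qed.

Lemma is_derive_gauss_pdf (R : realType) (x : R) :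
  is_derive x 1 (@gauss_pdf R) (- x * gauss_pdf x).
Proof.
rewrite /gauss_pdf.
apply: is_derive_eq.
rewrite /GRing.scale /=; field.
exact: sqrt_2pi_neq0.
Qed.

Lemma gauss_pdf_ge0 (R : realType) (x : R) : 0 <= gauss_pdf x.
Proof. by rewrite mulr_ge0 ?invr_ge0 ?sqrtr_ge0 ?expR_ge0. Qed.

(** The exponential is the square of [exp (- x^2 / 4)], and [exp (x^2 / 4) >= 1 + x^2 / 4]. This
    reduces the bounds on derivatives below to polynomial inequalities. *)
Lemma gauss_pdf_decay (R : realType) (x : R) :
  gauss_pdf x * (1 + x ^+ 2 / 4) ^+ 2 <= 1.
Proof.
have peak : (Num.sqrt (2 * pi))^-1 <= 1 :> R.
  rewrite invf_le1 ?sqrtr_gt0 ?mulr_gt0 ?pi_gt0 //.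
  rewrite -[leLHS]sqrtr1 ler_sqrt ?mulr_ge0 ?pi_ge0 //.
  by have := pi_ge2 R; lra.
have -> : gauss_pdf x = (Num.sqrt (2 * pi))^-1 * expR (- (x ^+ 2 / 4)) ^+ 2.
  by rewrite /gauss_pdf -expRM_natl; congr (_ * expR _); field.
rewrite -mulrA -exprMn mulr_ile1 ?invr_ge0 ?sqrtr_ge0 ?sqr_ge0 //.
have ge0 : 0 <= 1 + x ^+ 2 / 4 by rewrite addr_ge0 // divr_ge0 ?sqr_ge0.
rewrite expr_le1 ?mulr_ge0 ?expR_ge0 //.
by rewrite expRN mulrC ler_pdivrMr ?expR_gt0 // mul1r expR_ge1Dx.
Qed.

Lemma gauss_pdf_derive_le (R : realType) (x : R) : `|- x * gauss_pdf x| <= 1.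
Proof.
have := gauss_pdf_decay x; have := gauss_pdf_ge0 x.
move: (gauss_pdf x) => f f0 fx.
have linear (y : R) : y <= (1 + y ^+ 2 / 4) ^+ 2.
  by have := sqr_ge0 (y - 1); have := sqr_ge0 (y ^+ 2); nra.
have := ler_wpM2r f0 (linear x); have := ler_wpM2r f0 (linear (- x)).
rewrite sqrrN => ? ?.
by rewrite ler_norml; apply/andP; split; lra.
Qed.

Lemma gauss_pdf_derive2_le (R : realType) (x : R) :
  `|(x ^+ 2 - 1) * gauss_pdf x| <= 3.
Proof.
have := gauss_pdf_decay x; have := gauss_pdf_ge0 x.
move: (gauss_pdf x) => f f0 fx.
have x2 := sqr_ge0 x; have x4 := sqr_ge0 (x ^+ 2).
by rewrite ler_norml; apply/andP; split; nra.
Qed.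

Lemma gauss_pdf_cube_le (R : realType) (x : R) : `|x ^+ 3 * gauss_pdf x| <= 4.
Proof.
have := gauss_pdf_decay x; have := gauss_pdf_ge0 x.
move: (gauss_pdf x) => f f0 fx.
have cubic (y : R) : y ^+ 3 <= 4 * (1 + y ^+ 2 / 4) ^+ 2.
  by have := sqr_ge0 (y ^+ 2 / 2 - y); have := sqr_ge0 y; nra.
have := ler_wpM2r f0 (cubic x); have := ler_wpM2r f0 (cubic (- x)).
rewrite sqrrN exprNn -signr_odd /= expr1 mulN1r => ? ?.
by rewrite ler_norml; apply/andP; split; lra.
Qed.

(** Mean value theorem for either sign of [t]; the bound on [c] allows iterating it to get Taylor
    remainders. *)
Lemma MVT_origin (R : realType) (g dg : R -> R) (t : R) :
  (forall x : R, is_derive x 1 g (dg x)) -> g 0 = 0 ->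
  exists2 c, `|c| <= `|t| & g t = dg c * t.
Proof.
move=> gdg g0.
have cg (A : set R) : {within A, continuous g}.
  apply: continuous_subspaceT => x.
  apply: differentiable_continuous; apply/derivable1_diffP.
  by have [] := gdg x.
have [t0|t0] := leP 0 t.
  have [c] := MVT_segment t0 (fun x _ => gdg x) (cg _).
  rewrite in_itv /= => /andP[c0 ct]; rewrite g0 !subr0 => gt.
  by exists c => //; rewrite !ger0_norm.
have [c] := MVT_segment (ltW t0) (fun x _ => gdg x) (cg _).
rewrite in_itv /= => /andP[tc c0]; rewrite g0 !sub0r => gt.
exists c; first by rewrite !ler0_norm ?(ltW t0) // lerN2.
by apply: oppr_inj; rewrite gt mulrN.
Qed.

(** The remainder [r0] and its derivatives [r1], [r2] vanish at 0, so three mean value steps apply.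
    The quadratic term reflects that the second derivative of [gauss_cdf] is [- y * gauss_pdf y];
    the constant 3 bounds the third derivative. *)
Lemma gauss_cdf_taylor (R : realType) (y t : R) :
  `|gauss_cdf (y + t) - gauss_cdf y - t * gauss_pdf y
     + t ^+ 2 / 2 * (y * gauss_pdf y)| <= 3 * `|t| ^+ 3.
Proof.
pose r2 t := - (y + t) * gauss_pdf (y + t) + y * gauss_pdf y : R.
pose r1 t := gauss_pdf (y + t) - gauss_pdf y + t * (y * gauss_pdf y) : R.
pose r0 t := gauss_cdf (y + t) - gauss_cdf y - t * gauss_pdf y
  + t ^+ 2 / 2 * (y * gauss_pdf y).
have d2 (x : R) : is_derive x 1 r2 (((y + x) ^+ 2 - 1) * gauss_pdf (y + x)).
  have := is_derive_gauss_pdf (y + x) => ?.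
  rewrite /r2; apply: is_derive_eq; rewrite /GRing.scale /= /gauss_pdf.
  by field; exact: sqrt_2pi_neq0.
have d1 (x : R) : is_derive x 1 r1 (r2 x).
  have := is_derive_gauss_pdf (y + x) => ?.
  rewrite /r1 /r2; apply: is_derive_eq; rewrite /GRing.scale /= /gauss_pdf.
  by field; exact: sqrt_2pi_neq0.
have d0 (x : R) : is_derive x 1 r0 (r1 x).
  have := is_derive_gauss_cdf (y + x) => ?.
  rewrite /r0 /r1; apply: is_derive_eq; rewrite /GRing.scale /= /gauss_pdf.
  by field; exact: sqrt_2pi_neq0.
rewrite -/(r0 t).
have [|c0 c0t ->] := MVT_origin t d0; first by rewrite /r0 addr0; ring.
have [|c1 c1t ->] := MVT_origin c0 d1; first by rewrite /r1 addr0; ring.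
have [|c2 c2t ->] := MVT_origin c1 d2; first by rewrite /r2 addr0; ring.
have := gauss_pdf_derive2_le (y + c2); move: (_ * gauss_pdf _) => g g3.
have -> : 3 * `|t| ^+ 3 = 3 * `|t| * `|t| * `|t| by ring.
by rewrite !normrM !ler_pM ?mulr_ge0 // (le_trans c1t).
Qed.

(** A first-order expansion in the dilation [theta], with an error uniform in [y]: the second
    derivative in [theta] is controlled by the decay of the density. *)
Lemma gauss_cdf_scale (R : realType) (y theta : R) : 0 <= theta <= 2^-1 ->
  `|gauss_cdf (y * (1 - theta)) - gauss_cdf y + theta * (y * gauss_pdf y)|
    <= 16 * theta ^+ 2.
Proof.
move=> /andP[theta0 theta12].
pose r1 x := y * gauss_pdf y - y * gauss_pdf (y * (1 - x)) : R.
pose r0 x := gauss_cdf (y * (1 - x)) - gauss_cdf y + x * (y * gauss_pdf y).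
have d1 (x : R) : is_derive x 1 r1 (- y ^+ 3 * (1 - x) * gauss_pdf (y * (1 - x))).
  have := is_derive_gauss_pdf (y * (1 - x)) => ?.
  rewrite /r1; apply: is_derive_eq; rewrite /GRing.scale /= /gauss_pdf.
  by field; exact: sqrt_2pi_neq0.
have d0 (x : R) : is_derive x 1 r0 (r1 x).
  have := is_derive_gauss_cdf (y * (1 - x)) => ?.
  rewrite /r0 /r1; apply: is_derive_eq; rewrite /GRing.scale /= /gauss_pdf.
  by field; exact: sqrt_2pi_neq0.
rewrite -/(r0 theta).
have [|c0 c0t ->] := MVT_origin theta d0; first by rewrite /r0 subr0 mulr1; ring.
have [|c1 c1t ->] := MVT_origin c0 d1; first by rewrite /r1 subr0 mulr1; ring.
have /ler_normlP[_ c1_le] : `|c1| <= 2^-1.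
  by rewrite (le_trans c1t) // (le_trans c0t) // ger0_norm.
have pos : 2^-1 <= 1 - c1 by lra.
(* With [u = 1 - c1 >= 1/2], the quantity is [(y u)^3 * gauss_pdf (y u)] divided by [u^2], in
   absolute value at most [4 / (1/4)]. *)
have bound : `|- y ^+ 3 * (1 - c1) * gauss_pdf (y * (1 - c1))| <= 16.
  have := gauss_pdf_cube_le (y * (1 - c1)); rewrite exprMn.
  move: (gauss_pdf _) => f; move: (y ^+ 3) (1 - c1) pos => z u u12.
  rewrite !normrM normrN (ger0_norm (_ : 0 <= u)); last by lra.
  move: (normr_ge0 z) (normr_ge0 f); move: `|z| `|f| => Y F Y0 F0.
  rewrite -!mulrA.
  have : 0 <= Y * (u * F) by rewrite !mulr_ge0 //; lra.
  have -> : Y * (u * (u * (u * F))) = (Y * (u * F)) * u ^+ 2 by ring.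
  have : 4^-1 <= u ^+ 2 by nra.
  by move: (Y * (u * F)) (u ^+ 2) => a b; nra.
move: (_ * gauss_pdf _) bound => g g16.
have -> : 16 * theta ^+ 2 = 16 * theta * theta by ring.
have c0t' : `|c0| <= theta by rewrite (le_trans c0t) // ger0_norm.
by rewrite !normrM (ger0_norm theta0) ler_wpM2r // ler_pM.
Qed.

(** * Lindeberg replacement *)

(** Expansion of [rho], the inverse square root of [1 + delta]. Squaring and multiplying by
    [1 + delta] turns both bounds into polynomial inequalities in [delta]. *)
Lemma inv_sqrt_taylor (R : realFieldType) (delta rho : R) :
  0 <= delta -> delta <= 4^-1 -> 0 < rho -> rho ^+ 2 * (1 + delta) = 1 ->
  1 - delta / 2 <= rho <= 1 - delta / 2 + delta ^+ 2 / 2.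
Proof.
move=> d0 d4 rho0 rho2.
have d2 : 0 <= delta ^+ 2 by rewrite exprn_ge0.
have d3 : 0 <= delta ^+ 3 by rewrite exprn_ge0.
have d4' : 0 <= delta ^+ 4 by rewrite exprn_ge0.
have d5 : 0 <= delta ^+ 5 by rewrite exprn_ge0.
apply/andP; split.
  rewrite -(@ler_pXn2r _ 2) ?nnegrE ?(ltW rho0) //; last by lra.
  rewrite -(@ler_pM2r _ (1 + delta)) ?rho2; last by lra.
  by nra.
rewrite -(@ler_pXn2r _ 2) ?nnegrE ?(ltW rho0) //; last by lra.
rewrite -(@ler_pM2r _ (1 + delta)) ?rho2; last by lra.
by nra.
Qed.

(* One replacement: a centred Bernoulli step moves the heat solution
   [gauss_cdf (b / sigma)] by the same amount, up to third order, as adding the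
   variance [p (1 - p)] of the step to [sigma ^+ 2]. *)
Lemma gauss_cdf_bernoulli_step (R : realType) (p sigma b : R) :
  0 <= p <= 1 -> 1 <= sigma ->
  `|p * gauss_cdf ((b - (1 - p)) / sigma) + (1 - p) * gauss_cdf ((b + p) / sigma)
    - gauss_cdf (b / Num.sqrt (sigma ^+ 2 + p * (1 - p)))|
  <= 8 * (p * (1 - p)) / sigma ^+ 3.
Proof.
move=> /andP[p0 p1] s1; have s0 : 0 < sigma by lra.
pose h := sigma^-1; pose v := p * (1 - p); pose y := b / sigma.
have h0 : 0 < h by rewrite invr_gt0.
have h1 : h <= 1 by rewrite invf_le1.
have v0 : 0 <= v by rewrite mulr_ge0 // subr_ge0.
have v4 : v <= 4^-1 by rewrite /v; have := sqr_ge0 (p - 2^-1); nra.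
pose delta := v * h ^+ 2.
have h2 : 0 <= h ^+ 2 <= 1 by rewrite sqr_ge0 expr_le1 // ltW.
have delta0 : 0 <= delta by rewrite mulr_ge0 // ltW // exprn_gt0.
have delta4 : delta <= 4^-1.
  by rewrite /delta; move: (h ^+ 2) h2 => z /andP[z0 z1]; nra.
(* Adding the variance [v] dilates [y = b / sigma] by [rho], that is by [1 - theta] with
   [theta = 1 - rho] close to [delta / 2]. *)
pose rho := sigma / Num.sqrt (sigma ^+ 2 + v).
have sv0 : 0 < sigma ^+ 2 + v by rewrite ltr_wpDr // exprn_gt0.
have rho0 : 0 < rho by rewrite divr_gt0 // sqrtr_gt0.
have rho2 : rho ^+ 2 * (1 + delta) = 1.
  rewrite /rho exprMn exprVn sqr_sqrtr ?ltW // /delta /h.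
  by field; rewrite !gt_eqF.
have /andP[rho_ge rho_le] := inv_sqrt_taylor delta0 delta4 rho0 rho2.
have rho1 : rho <= 1 by move: rho_le; nra.
have th : 0 <= 1 - rho <= 2^-1 by apply/andP; split; lra.
have Hs := gauss_cdf_scale y th; rewrite subKr in Hs.
have yrho : y * rho = b / Num.sqrt (sigma ^+ 2 + v).
  by rewrite /y /rho; field; rewrite !gt_eqF // sqrtr_gt0.
have q0 : 0 <= 1 - p by lra.
have Hp := gauss_cdf_taylor y (p * h).
rewrite (_ : y + p * h = (b + p) / sigma) in Hp; last by rewrite /y /h; ring.
rewrite (ger0_norm (mulr_ge0 p0 (ltW h0))) in Hp.
have Hm := gauss_cdf_taylor y (- ((1 - p) * h)).
rewrite (_ : y + - ((1 - p) * h) = (b - (1 - p)) / sigma) in Hm; last first.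
  by rewrite /y /h; ring.
rewrite normrN (ger0_norm (mulr_ge0 q0 (ltW h0))) in Hm.
have f'1 : `|y * gauss_pdf y| <= 1.
  by have := gauss_pdf_derive_le y; rewrite mulNr normrN.
have -> : 8 * (p * (1 - p)) / sigma ^+ 3 = 8 * v * h ^+ 3 by rewrite /h exprVn.
move: Hs Hp Hm f'1; rewrite yrho -/v.
move: (gauss_cdf (b / Num.sqrt (sigma ^+ 2 + v))) => Fs.
move: (gauss_cdf ((b + p) / sigma)) (gauss_cdf ((b - (1 - p)) / sigma)) => Fp Fm.
move: (gauss_cdf y) (gauss_pdf y) (y * gauss_pdf y) => F f f' Hs Hp Hm f'1.
have {}Hs : `|Fs - F + (1 - rho) * f'| <= 4 * delta ^+ 2.
  apply: le_trans Hs _; have : (1 - rho) ^+ 2 <= (delta / 2) ^+ 2.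
    have r0 : 0 <= 1 - rho by rewrite subr_ge0.
    have rd : 1 - rho <= delta / 2 by rewrite lerBlDr -lerBlDl.
    by rewrite ler_pXn2r // nnegrE // divr_ge0.
  by rewrite exprMn; lra.
have rem : `|(delta / 2 - (1 - rho)) * f'| <= delta ^+ 2 / 2.
  rewrite normrM -[leRHS]mulr1 ler_pM //.
  by rewrite ger0_norm; lra.
have {}Hm : `|p * (Fm - F - - ((1 - p) * h) * f
    + (- ((1 - p) * h)) ^+ 2 / 2 * f')| <= 3 * v * h ^+ 3 * (1 - p) ^+ 2.
  rewrite normrM (ger0_norm p0).
  apply: le_trans (ler_wpM2l p0 Hm) _.
  by rewrite /v le_eqVlt; apply/orP; left; apply/eqP; ring.
have {}Hp : `|(1 - p) * (Fp - F - p * h * f + (p * h) ^+ 2 / 2 * f')|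
    <= 3 * v * h ^+ 3 * p ^+ 2.
  rewrite normrM (ger0_norm q0).
  apply: le_trans (ler_wpM2l q0 Hp) _.
  by rewrite /v le_eqVlt; apply/orP; left; apply/eqP; ring.
(* The linear terms cancel because the step is centred. The quadratic ones sum to [delta / 2 * f'],
   since [p (1-p)^2 + (1-p) p^2 = p (1-p)], and match the dilation up to [delta / 2 - (1 - rho)]. *)
have -> : p * Fm + (1 - p) * Fp - Fs =
    p * (Fm - F - - ((1 - p) * h) * f + (- ((1 - p) * h)) ^+ 2 / 2 * f')
    + (1 - p) * (Fp - F - p * h * f + (p * h) ^+ 2 / 2 * f')
    - (Fs - F + (1 - rho) * f') - (delta / 2 - (1 - rho)) * f'.
  by rewrite /delta /v; field.
apply: le_trans (ler_normB _ _) _; apply: le_trans (lerD (ler_normB _ _) (lexx _)) _.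
apply: le_trans (lerD (lerD (ler_normD _ _) (lexx _)) (lexx _)) _.
apply: le_trans (lerD (lerD (lerD Hm Hp) Hs) rem) _.
(* In units of [v h^3], the Taylor remainders cost at most 3 and the two multiples of [delta^2] at
   most [4 + 1/2], hence the constant 8. *)
have vh : 0 <= v * h ^+ 3 by rewrite mulr_ge0 // exprn_ge0 // ltW.
have dle : delta ^+ 2 <= v * h ^+ 3.
  have -> : delta ^+ 2 = (v * h ^+ 3) * (v * h) by rewrite /delta; ring.
  by rewrite ler_piMr //; nra.
have : (1 - p) ^+ 2 + p ^+ 2 <= 1 by nra.
move=> /(ler_wpM2l vh); rewrite mulr1 mulrDr.
have E3 x : 3 * v * h ^+ 3 * x = 3 * (v * h ^+ 3 * x) by ring.
rewrite !E3 (_ : 8 * v * h ^+ 3 = 8 * (v * h ^+ 3)); last by ring.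
move: (v * h ^+ 3 * (1 - p) ^+ 2) (v * h ^+ 3 * p ^+ 2) => u1 u2.
by move: (v * h ^+ 3) vh (delta ^+ 2) dle => u u0 d du; lra.
Qed.

(** The steps are replaced one at a time, each moving its mean into the threshold and its variance
    into [tau]; the errors of the single replacements add up. *)
Lemma bernoulli_lindeberg (R : realType) (s : seq R) (a x tau : R) :
  {in s, forall p, 0 <= p <= 1} -> 1 <= tau ->
  `|bernoulli_mean s (fun w => gauss_cdf ((a - w) / Num.sqrt tau)) x
    - gauss_cdf ((a - x - \sum_(p <- s) p)
                 / Num.sqrt (tau + \sum_(p <- s) p * (1 - p)))|
  <= 8 * (\sum_(p <- s) p * (1 - p)) / Num.sqrt tau ^+ 3.
Proof.
move=> + tau1; elim: s x => [|p s IHs] x s01 /=.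
  by rewrite !big_nil subr0 addr0 subrr normr0 mulr0 mul0r.
have p01 := s01 p (mem_head p s).
have {}s01 : {in s, forall p, 0 <= p <= 1}.
  by move=> q qs; apply: s01; rewrite inE qs orbT.
rewrite !big_cons.
have V0 : 0 <= \sum_(q <- s) q * (1 - q).
  rewrite big_seq; apply: sumr_ge0 => q /s01 /andP[q0 q1].
  by rewrite mulr_ge0 // subr_ge0.
move: (IHs (x + 1) s01) (IHs x s01); set V := \sum_(q <- s) q * (1 - q).
set m := \sum_(q <- s) q; set e := 8 * V / _ => H1 H0.
have tau0 : 1 <= Num.sqrt tau by rewrite -[leLHS]sqrtr1 ler_sqrt //; lra.
have s1 : Num.sqrt tau <= Num.sqrt (tau + V).
  by rewrite ler_sqrt; [rewrite lerDl|rewrite addr_ge0 //; lra].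
(* The tail of [s] is already replaced. The variance [V] it has contributed only enlarges the
   denominator, so the error is at most the one with [tau] alone. *)
have := gauss_cdf_bernoulli_step (a - x - m - p) p01 (le_trans tau0 s1).
rewrite sqr_sqrtr; last by rewrite addr_ge0 //; lra.
have -> : a - x - m - p - (1 - p) = a - (x + 1) - m by ring.
have -> : a - x - m - p + p = a - x - m by ring.
have -> : a - x - m - p = a - x - (p + m) by ring.
have -> : tau + V + p * (1 - p) = tau + (p * (1 - p) + V) by ring.
move=> Hs.
have {}Hs := le_trans Hs (_ : _ <= 8 * (p * (1 - p)) / Num.sqrt tau ^+ 3).
have /andP[p0 p1] := p01.
have {Hs} := Hs _; set F1 := gauss_cdf ((a - (x + 1) - m) / _) in H1 *.
set F0 := gauss_cdf ((a - x - m) / _) in H0 *.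
set G := gauss_cdf (_ / Num.sqrt (tau + (_ + _))) => Hs.
rewrite mulrDr mulrDl -/e.
have -> : p * bernoulli_mean s (fun w => gauss_cdf ((a - w) / Num.sqrt tau)) (x + 1)
  + (1 - p) * bernoulli_mean s (fun w => gauss_cdf ((a - w) / Num.sqrt tau)) x - G
  = p * (bernoulli_mean s (fun w => gauss_cdf ((a - w) / Num.sqrt tau)) (x + 1) - F1)
  + (1 - p) * (bernoulli_mean s (fun w => gauss_cdf ((a - w) / Num.sqrt tau)) x - F0)
  + (p * F1 + (1 - p) * F0 - G) by ring.
apply: le_trans (ler_normD _ _) _; rewrite addrC lerD //.
  apply: Hs; rewrite ler_wpM2l ?mulr_ge0 ?subr_ge0 // lef_pV2 ?posrE ?exprn_gt0 //.
  - by rewrite ler_pXn2r ?nnegrE ?sqrtr_ge0.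
  - by lra.
  - by lra.
apply: le_trans (ler_normD _ _) _; rewrite !normrM (ger0_norm p0).
rewrite (ger0_norm (_ : 0 <= 1 - p)) ?subr_ge0 //.
have q0 : 0 <= 1 - p by rewrite subr_ge0.
have := lerD (ler_wpM2l p0 H1) (ler_wpM2l q0 H0).
by move=> /le_trans; apply; rewrite -mulrDl addrC subrK mul1r.
Qed.

(** * Limits *)

Lemma cvg_near_eq (T : topologicalType) (f g : nat -> T) (l : T) :
  (\forall n \near \oo, f n = g n) -> g n @[n --> \oo] --> l ->
  f n @[n --> \oo] --> l.
Proof.
move=> fg; apply: cvg_trans; apply: near_eq_cvg.
by apply: filterS fg => n ->.
Qed.

Lemma cvg0_norm_le (R : realType) (f g : nat -> R) :
  (\forall n \near \oo, `|f n| <= g n) -> g n @[n --> \oo] --> 0 ->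
  f n @[n --> \oo] --> 0.
Proof.
move=> fg g0; apply/norm_cvg0P; apply: squeeze_cvgr (cvg_cst 0) g0.
by apply: filterS fg => n ->; rewrite normr_ge0.
Qed.

Lemma cvg0_bounded_mul (R : realType) (f g : nat -> R) (B : R) :
  (\forall n \near \oo, `|f n| <= B) -> g n @[n --> \oo] --> 0 ->
  f n * g n @[n --> \oo] --> 0.
Proof.
move=> fB g0.
have ng0 : `|g n| @[n --> \oo] --> (0 : R).
  by rewrite -[X in _ --> X](normr0 R); exact: cvg_norm.
apply: (@cvg0_norm_le _ _ (fun n => B * `|g n|)).
  by apply: filterS fB => n fnB; rewrite normrM ler_wpM2r.
by rewrite -(mulr0 B); apply: cvgM => //; exact: cvg_cst.
Qed.

(** * Ratios of binomial coefficients *)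

Lemma cvg_natr_inv (R : realType) (a : R) :
  (n%:R - a)^-1 @[n --> \oo] --> (0 : R).
Proof.
apply/gtr0_cvgV0.
  near=> n; rewrite subr_gt0; near: n; exact: nbhs_infty_gtr.
apply/cvgryPge => A; near=> n; rewrite lerBrDr; near: n; exact: nbhs_infty_ger.
Unshelve. all: by end_near. Qed.

(** Passing from [j] to [j + 1] multiplies the ratio by [(n + j + 1) / (n - j) = 1 + (2j + 1) / (n -
    j)], which tends to 1. *)
Lemma cvg_bin_add_ratio (R : realType) (j : nat) :
  'C(n + j, j)%:R / 'C(n, j)%:R @[n --> \oo] --> (1 : R).
Proof.
elim: j => [|j IHj].
  apply: cvg_near_eq (cvg_cst (1 : R)).
  by apply: nearW => n; rewrite !bin0 divr1.
have step : \forall n \near \oo, 'C(n + j, j)%:R / 'C(n, j)%:R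
    * (1 + (j + j).+1%:R * (n%:R - j%:R)^-1) =
    'C(n + j.+1, j.+1)%:R / 'C(n, j.+1)%:R :> R.
  near=> n; have jn : (j < n)%N by near: n; exact: nbhs_infty_gt.
  have C0 i : (i <= n)%N -> 'C(n, i)%:R != 0 :> R.
    by move=> ni; rewrite pnatr_eq0 -lt0n bin_gt0.
  have := mul_bin_diag (n + j.+1) j; rewrite addnS /= => /(congr1 (fun m => m%:R : R)).
  have := mul_bin_left n j => /(congr1 (fun m => m%:R : R)).
  rewrite !natrM natrB ?(ltnW jn) // => e1 e2.
  have nj : n%:R - j%:R != 0 :> R by rewrite subr_eq0 eqr_nat gtn_eqF.
  have e2' : 'C((n + j).+1, j.+1)%:R =
      (n + j).+1%:R * 'C(n + j, j)%:R / j.+1%:R :> R.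
    by rewrite e2 mulrC mulKf // pnatr_eq0.
  have e1' : 'C(n, j.+1)%:R = (n%:R - j%:R) * 'C(n, j)%:R / j.+1%:R :> R.
    by rewrite -e1 mulrC mulKf // pnatr_eq0.
  rewrite e1' e2'; have := C0 j (ltnW jn); move: 'C(n + j, j)%:R 'C(n, j)%:R => u w w0.
  have j0 : j.+1%:R != 0 :> R by rewrite pnatr_eq0.
  rewrite -[(n + j).+1%:R]natr1 natrD -[(j + j).+1%:R]natr1 natrD.
  by move: j.+1%:R j0 => a a0; field; rewrite w0 nj a0.
apply: (cvg_near_eq (filterS (fun n e => esym e) step)).
rewrite -[X in _ --> X](_ : 1 * (1 + (j + j).+1%:R * 0) = 1); last first.
  by rewrite mulr0 addr0 mul1r.
apply: cvgM => //; apply: cvgD; first exact: cvg_cst.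
by apply: cvgM; [exact: cvg_cst|exact: cvg_natr_inv].
Unshelve. all: by end_near. Qed.

(** Each increment of [m] brings a factor [(j + m + 1) / (n - j - m)], which tends to 0. *)
Lemma cvg_bin_ratio (R : realType) (j m : nat) :
  'C(n, j)%:R / 'C(n, j + m)%:R @[n --> \oo] --> ((m == 0%N)%:R : R).
Proof.
elim: m => [|m IHm].
  apply: cvg_near_eq (cvg_cst (1 : R)).
  near=> n; rewrite addn0 divff // pnatr_eq0 -lt0n bin_gt0.
  by near: n; exact: nbhs_infty_ge.
have step : \forall n \near \oo, 'C(n, j)%:R / 'C(n, j + m)%:R
    * ((j + m).+1%:R * (n%:R - (j + m)%:R)^-1) =
    'C(n, j)%:R / 'C(n, j + m.+1)%:R :> R.
  near=> n; have jn : (j + m < n)%N by near: n; exact: nbhs_infty_gt.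
  have := mul_bin_left n (j + m) => /(congr1 (fun m => m%:R : R)).
  rewrite !natrM natrB ?(ltnW jn) // => e1.
  have nj : n%:R - (j + m)%:R != 0 :> R by rewrite subr_eq0 eqr_nat gtn_eqF.
  have e1' : 'C(n, (j + m).+1)%:R =
      (n%:R - (j + m)%:R) * 'C(n, j + m)%:R / (j + m).+1%:R :> R.
    by rewrite -e1 mulrC mulKf // pnatr_eq0.
  rewrite addnS e1'.
  have : 'C(n, j + m)%:R != 0 :> R by rewrite pnatr_eq0 -lt0n bin_gt0 ltnW.
  have : (j + m).+1%:R != 0 :> R by rewrite pnatr_eq0.
  move: (j + m).+1%:R (n%:R - _) nj 'C(n, j)%:R 'C(n, j + m)%:R => a b b0 u w a0 w0.
  by field; rewrite a0 b0 w0.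
apply: (cvg_near_eq (filterS (fun n e => esym e) step)).
rewrite -[X in _ --> X](_ : (m == 0%N)%:R * ((j + m).+1%:R * 0) = 0); last first.
  by rewrite !mulr0.
apply: cvgM => //.
by apply: cvgM; [exact: cvg_cst|exact: cvg_natr_inv].
Unshelve. all: by end_near. Qed.

(** * Reduction of the face ratio to a single probability *)

Lemma below_prob_ge0 (R : realType) (j n d : nat) : 0 <= below_prob R j n d.
Proof.
apply: le_trans (bernoulli_mean_le (f := fun w => 0 * w + 0) 0
  (@step_probs01 R j n) _).
  by rewrite bernoulli_mean_affine mul0r addr0.
by move=> w; rewrite mul0r addr0.
Qed.

Lemma below_prob_le1 (R : realType) (j n d : nat) : below_prob R j n d <= 1.
Proof.
apply: le_trans (bernoulli_mean_le (g := fun w => 0 * w + 1) 0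
  (@step_probs01 R j n) _) _.
  by move=> w; rewrite mul0r add0r lern1 leq_b1.
by rewrite bernoulli_mean_affine mul0r add0r.
Qed.

(** For [j < k] the binomial ratio tends to 0 while [below_prob] stays in [[0, 1]]; the term [j = k]
    has sign 1 and binomial ratio tending to 1. *)
Lemma face_ratio_cvg (R : realType) (n : nat -> nat) (k : nat) (L : R) :
  (forall d : nat, (0 < d)%N -> (d <= n d)%N) ->
  below_prob R k (n d) d @[d --> \oo] --> L ->
  (\sum_(j < k.+1) (-1) ^+ (k - j) *+ 'C(k, j) * 'C(n d + j, j)%:R
       * below_prob R j (n d) d) / 'C(n d, k)%:R @[d --> \oo] --> L.
Proof.
move=> n_ge bL.
have ny : n d @[d --> \oo] --> \oo.
  apply/cvgnyPge => A; near=> d; apply: leq_trans (n_ge _ _).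
    by near: d; exact: nbhs_infty_ge.
  by near: d; exact: nbhs_infty_gt.
have ratio j : (j <= k)%N ->
    'C(n d + j, j)%:R / 'C(n d, k)%:R @[d --> \oo] --> ((j == k)%:R : R).
  move=> jk.
  have : 'C(m + j, j)%:R / 'C(m, j)%:R * ('C(m, j)%:R / 'C(m, j + (k - j))%:R)
      @[m --> \oo] --> (1 * ((k - j)%N == 0%N)%:R : R).
    by apply: cvgM; [exact: cvg_bin_add_ratio|exact: cvg_bin_ratio].
  rewrite mul1r subn_eq0 subnKC // => /(cvg_comp _ _ ny) /=.
  rewrite (_ : (j == k) = (k <= j)%N); last by rewrite eqn_leq jk.
  apply: cvg_trans; apply: near_eq_cvg; near=> d => /=.
  rewrite mulrA divfK // pnatr_eq0 -lt0n bin_gt0 (leq_trans jk) //.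
  apply: leq_trans (n_ge d _); near: d; [exact: nbhs_infty_ge|exact: nbhs_infty_gt].
apply: (@cvg_near_eq _ _ (fun d => \sum_(j < k) (-1) ^+ (k - j) *+ 'C(k, j)
    * (below_prob R j (n d) d * ('C(n d + j, j)%:R / 'C(n d, k)%:R))
    + 'C(n d + k, k)%:R / 'C(n d, k)%:R * below_prob R k (n d) d)).
  apply: nearW => d; rewrite big_ord_recr /= subnn expr0 binn mul1r mulrDl.
  congr (_ + _); last by rewrite mulrAC.
  by rewrite mulr_suml; apply: eq_bigr => j _; ring.
rewrite -[X in _ --> X]add0r; apply: cvgD; last first.
  rewrite -[X in _ --> X]mul1r; apply: cvgM => //.
  by have := ratio k (leqnn k); rewrite eqxx.
rewrite [X in _ --> X](_ : 0 = \sum_(j < k) 0); last by rewrite big1.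
apply: cvg_big => [|j _]; first exact: add_continuous.
have := ratio j (ltnW (ltn_ord j)); rewrite ltn_eqF // => rj.
rewrite -[X in _ --> X](mulr0 ((-1) ^+ (k - j) *+ 'C(k, j))).
apply: cvgM; first exact: cvg_cst.
apply: (@cvg0_bounded_mul _ _ _ 1) => //.
by apply: nearW => d; rewrite ger0_norm ?below_prob_ge0 ?below_prob_le1.
Unshelve. all: by end_near. Qed.

(** * Smoothing and Chebyshev bounds *)

(** For [w < D] the quotient [(D + t^6 - w) / t^5] is at least [t], so adding [1 - gauss_cdf t] to
    [gauss_cdf] of it majorizes the indicator. Lindeberg replacement with [tau = t^10] estimates the
    mean of this majorant. *)
Lemma bernoulli_below_le (R : realType) (s : seq R) (D t : R) :
  {in s, forall p, 0 <= p <= 1} -> 1 <= t ->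
  bernoulli_mean s (fun w => ((w < D)%R)%:R) 0 <=
  gauss_cdf ((D + t ^+ 6 - \sum_(p <- s) p)
             / Num.sqrt (t ^+ 10 + \sum_(p <- s) p * (1 - p)))
  + 8 * (\sum_(p <- s) p * (1 - p)) / t ^+ 15 + (1 - gauss_cdf t).
Proof.
move=> s01 t1; have t0 : 0 < t by lra.
have sqt : Num.sqrt (t ^+ 10) = t ^+ 5.
  by rewrite (exprM t 5 2) sqrtr_sqr ger0_norm // exprn_ge0 // ltW.
have := @bernoulli_lindeberg _ s (D + t ^+ 6) 0 (t ^+ 10) s01 (exprn_ege1 _ t1).
rewrite subr0 sqt -exprM => /ler_normlP[_ lind].
apply: le_trans (bernoulli_mean_le (g := fun w =>
  1 * gauss_cdf ((D + t ^+ 6 - w) / t ^+ 5) + (1 - gauss_cdf t)) 0 s01 _) _.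
  move=> w; rewrite mul1r; case: ltP => wD.
    have : gauss_cdf t <= gauss_cdf ((D + t ^+ 6 - w) / t ^+ 5).
      apply: gauss_cdf_le; rewrite ler_pdivlMr ?exprn_gt0 // -exprS; lra.
    by rewrite mulr1n; lra.
  rewrite mulr0n addr_ge0 ?gauss_cdf_ge0 // subr_ge0; exact: gauss_cdf_le1.
rewrite bernoulli_mean_affine mul1r lerD2r.
by move: lind; lra.
Qed.

(** With the threshold lowered by [t^6] the quotient is at most [- t] for [w >= D], so subtracting
    [gauss_cdf (- t)] leaves a minorant of the indicator. *)
Lemma bernoulli_below_ge (R : realType) (s : seq R) (D t : R) :
  {in s, forall p, 0 <= p <= 1} -> 1 <= t ->
  gauss_cdf ((D - t ^+ 6 - \sum_(p <- s) p)
             / Num.sqrt (t ^+ 10 + \sum_(p <- s) p * (1 - p)))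
  - 8 * (\sum_(p <- s) p * (1 - p)) / t ^+ 15 - gauss_cdf (- t) <=
  bernoulli_mean s (fun w => ((w < D)%R)%:R) 0.
Proof.
move=> s01 t1; have t0 : 0 < t by lra.
have sqt : Num.sqrt (t ^+ 10) = t ^+ 5.
  by rewrite (exprM t 5 2) sqrtr_sqr ger0_norm // exprn_ge0 // ltW.
have := @bernoulli_lindeberg _ s (D - t ^+ 6) 0 (t ^+ 10) s01 (exprn_ege1 _ t1).
rewrite subr0 sqt -exprM => /ler_normlP[lind _].
apply: le_trans (bernoulli_mean_le (f := fun w =>
  1 * gauss_cdf ((D - t ^+ 6 - w) / t ^+ 5) - gauss_cdf (- t)) 0 s01 _).
  rewrite bernoulli_mean_affine mul1r lerD2r.
  by move: lind; lra.
move=> w; rewrite mul1r; case: ltP => wD.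
  have := gauss_cdf_le1 ((D - t ^+ 6 - w) / t ^+ 5).
  by have := gauss_cdf_ge0 (- t); rewrite mulr1n; lra.
rewrite mulr0n subr_le0; apply: gauss_cdf_le.
by rewrite ler_pdivrMr ?exprn_gt0 // mulNr -exprS; lra.
Qed.

Lemma below_prob_chebyshev_lt (R : realType) (k n d : nat) :
  \sum_(p <- step_probs R k n) p < d%:R ->
  1 - below_prob R k n d <= (\sum_(p <- step_probs R k n) p * (1 - p))
    / (d%:R - \sum_(p <- step_probs R k n) p) ^+ 2.
Proof.
move=> md; have -> : 1 - below_prob R k n d = bernoulli_mean (step_probs R k n)
    (fun w => -1 * ((w < d%:R)%R)%:R + 1) 0.
  by rewrite bernoulli_mean_affine mulN1r addrC.
apply: bernoulli_chebyshev => [|w]; first exact: step_probs01.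
case: ltP => wd; first by rewrite mulr1n mulr1 addNr divr_ge0 // sqr_ge0.
rewrite mulr0 add0r ler_pdivlMr ?exprn_gt0 ?subr_gt0 // mul1r.
by rewrite ler_pXn2r ?nnegrE ?subr_ge0 ?lerD2r //; lra.
Qed.

Lemma below_prob_chebyshev_gt (R : realType) (k n d : nat) :
  d%:R < \sum_(p <- step_probs R k n) p ->
  below_prob R k n d <= (\sum_(p <- step_probs R k n) p * (1 - p))
    / (\sum_(p <- step_probs R k n) p - d%:R) ^+ 2.
Proof.
move=> dm; apply: bernoulli_chebyshev => [|w]; first exact: step_probs01.
case: ltP => wd; last by rewrite mulr0n divr_ge0 // sqr_ge0.
rewrite mulr1n ler_pdivlMr ?exprn_gt0 ?subr_gt0 // mul1r -[X in _ <= X]sqrrN opprB.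
by rewrite ler_pXn2r ?nnegrE ?subr_ge0 //; lra.
Qed.

(** * Limits of [below_prob] in the three regimes *)

Lemma below_prob_cvg1 (R : realType) (n : nat -> nat) (k : nat) (q : R) :
  (forall d : nat, (0 < d)%N -> (d <= n d)%N) -> q < 1 ->
  (\forall d \near \oo, (k%:R + 2^-1) * ln (n d)%:R <= q * d%:R) ->
  below_prob R k (n d) d @[d --> \oo] --> (1 : R).
Proof.
move=> n_ge q1 Lq; have [C mom] := step_probs_moments R k.
suff : 1 - below_prob R k (n d) d @[d --> \oo] --> (0 : R).
  move/(cvgB (cvg_cst (1 : R))); rewrite subr0; apply: cvg_near_eq.
  by apply: nearW => d /=; rewrite opprB addrC subrK.
have e0 : 0 < 1 - q by lra.
(* Chebyshev: for large [d] half of the gap [(1 - q) d] absorbs [C], and the variance is at most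
   [2 d]; [2 d] over [((1 - q) d / 2)^2] is this bound. *)
apply: (@cvg0_norm_le _ _ (fun d => 8 / (1 - q) ^+ 2 * (d%:R - 0)^-1)); last first.
  rewrite -(mulr0 (8 / (1 - q) ^+ 2)).
  by apply: cvgM; [exact: cvg_cst|exact: cvg_natr_inv].
near=> d.
rewrite subr0 ger0_norm; last by rewrite subr_ge0 below_prob_le1.
have d0 : 0 < d%:R :> R by near: d; exact: nbhs_infty_gtr.
have kn : (k < n d)%N.
  apply: leq_trans (n_ge d _); last by rewrite -(ltr0n R).
  by near: d; exact: nbhs_infty_gt.
have Lq' : (k%:R + 2^-1) * ln (n d)%:R <= q * d%:R by near: d.
have Cd : C <= d%:R by near: d; exact: nbhs_infty_ger.
have Ce : C / (1 - q) * 2 <= d%:R by near: d; exact: nbhs_infty_ger.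
have {}Ce : C <= (1 - q) * d%:R / 2.
  by move: Ce; rewrite mulrAC ler_pdivrMr //; lra.
have [/ler_normlP[_ m_le] /ler_normlP[_ V_le]] := mom _ kn.
set m := \sum_(p <- _) p in m_le *; set V := \sum_(p <- _) _ in V_le *.
have tm : (1 - q) * d%:R / 2 <= d%:R - m by lra.
have t0 : 0 < (1 - q) * d%:R / 2 by rewrite divr_gt0 // mulr_gt0.
apply: le_trans (below_prob_chebyshev_lt _) _.
  by rewrite -subr_gt0; exact: lt_le_trans tm.
rewrite -/m -/V ler_pdivrMr; last by rewrite exprn_gt0 //; exact: lt_le_trans tm.
have tm2 : ((1 - q) * d%:R / 2) ^+ 2 <= (d%:R - m) ^+ 2.
  by rewrite ler_pXn2r ?nnegrE ?(ltW t0) // (le_trans (ltW t0)).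
have c0 : 0 <= 8 / (1 - q) ^+ 2 / d%:R by rewrite !divr_ge0 // ?sqr_ge0 // ltW.
apply: le_trans _ (ler_wpM2l c0 tm2).
have -> : 8 / (1 - q) ^+ 2 / d%:R * ((1 - q) * d%:R / 2) ^+ 2 = 2 * d%:R.
  by field; rewrite !gt_eqF.
by have := mulr_gt0 e0 d0; lra.
Unshelve. all: by end_near. Qed.

Lemma below_prob_cvg0 (R : realType) (n : nat -> nat) (k : nat) (q : R) :
  (forall d : nat, (0 < d)%N -> (d <= n d)%N) -> 1 < q ->
  (\forall d \near \oo, q * d%:R <= (k%:R + 2^-1) * ln (n d)%:R) ->
  below_prob R k (n d) d @[d --> \oo] --> (0 : R).
Proof.
move=> n_ge q1 Lq; have [C mom] := step_probs_moments R k.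
have q0 : 0 < q by lra.
(* [q d <= L] reads [d <= (1 - e) L]. As [L] may outgrow [d], the gap [e L / 2] and the variance
   bound [2 L] are measured in [L]; [L >= d] is used only at the end. *)
pose e := 1 - q^-1.
have e0 : 0 < e by rewrite subr_gt0 invf_lt1.
apply: (@cvg0_norm_le _ _ (fun d => 8 / e ^+ 2 * (d%:R - 0)^-1)); last first.
  by rewrite -(mulr0 (8 / e ^+ 2)); apply: cvgM; [exact: cvg_cst|exact: cvg_natr_inv].
near=> d.
rewrite subr0 ger0_norm ?below_prob_ge0 //.
have d0 : 0 < d%:R :> R by near: d; exact: nbhs_infty_gtr.
have kn : (k < n d)%N.
  apply: leq_trans (n_ge d _); last by rewrite -(ltr0n R).
  by near: d; exact: nbhs_infty_gt.
have Lq' : q * d%:R <= (k%:R + 2^-1) * ln (n d)%:R by near: d.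
have Cd : C <= d%:R by near: d; exact: nbhs_infty_ger.
have Ce : C / e * 2 <= d%:R by near: d; exact: nbhs_infty_ger.
have {}Ce : C <= e * d%:R / 2 by move: Ce; rewrite mulrAC ler_pdivrMr //; lra.
have [/ler_normlP[m_ge _] /ler_normlP[_ V_le]] := mom _ kn.
set m := \sum_(p <- _) p in m_ge *; set V := \sum_(p <- _) _ in V_le *.
set L := (k%:R + 2^-1) * ln (n d)%:R in Lq' m_ge V_le.
have dL : d%:R <= L by apply: le_trans Lq'; rewrite ler_peMl // ltW.
have L0 : 0 < L by exact: lt_le_trans dL.
have dL' : d%:R <= (1 - e) * L.
  by rewrite /e subKr mulrC ler_pdivlMr // mulrC.
have eL : e * d%:R <= e * L by rewrite ler_pM2l.
have tm : e * L / 2 <= m - d%:R by lra.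
have t0 : 0 < e * L / 2 by rewrite divr_gt0 // mulr_gt0.
apply: le_trans (below_prob_chebyshev_gt _) _.
  by rewrite -subr_gt0; exact: lt_le_trans tm.
rewrite -/m -/V ler_pdivrMr; last by rewrite exprn_gt0 //; exact: lt_le_trans tm.
have tm2 : (e * L / 2) ^+ 2 <= (m - d%:R) ^+ 2.
  by rewrite ler_pXn2r ?nnegrE ?(ltW t0) // (le_trans (ltW t0)).
have c0 : 0 <= 8 / e ^+ 2 / d%:R by rewrite !divr_ge0 // ?sqr_ge0 // ltW.
apply: le_trans _ (ler_wpM2l c0 tm2).
have -> : 8 / e ^+ 2 / d%:R * (e * L / 2) ^+ 2 = 2 * L * (L / d%:R).
  by field; rewrite !gt_eqF.
have : 1 <= L / d%:R by rewrite ler_pdivlMr // mul1r.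
by move: (L / d%:R) => z z1; nra.
Unshelve. all: by end_near. Qed.

(** A strict inequality for the possibly infinite limit leaves a fixed gap for the tail of the
    sequence. *)
Lemma ereal_cvg_lt (R : realType) (u : nat -> R) (g : \bar R) (a : R) :
  (u d)%:E @[d --> \oo] --> g -> (g < a%:E)%E ->
  exists2 b, b < a & \forall d \near \oo, u d <= b.
Proof.
case: g => [r|//|] ug.
  rewrite lte_fin => ra; exists ((r + a) / 2); first by lra.
  have /fine_cvgP[_ ur] := ug.
  have : r < (r + a) / 2 by lra.
  by move=> /(cvgr_lt _ ur); apply: filterS => d /ltW.
move=> _; exists (a - 1); first by lra.
move/cvgeNyPlt : ug => /(_ (a - 1)).
by apply: filterS => d; rewrite lte_fin => /ltW.
Qed.

Lemma ereal_cvg_gt (R : realType) (u : nat -> R) (g : \bar R) (a : R) :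
  (u d)%:E @[d --> \oo] --> g -> (a%:E < g)%E ->
  exists2 b, a < b & \forall d \near \oo, b <= u d.
Proof.
case: g => [r| |//] ug.
  rewrite lte_fin => ra; exists ((r + a) / 2); first by lra.
  have /fine_cvgP[_ ur] := ug.
  have : (r + a) / 2 < r by lra.
  by move=> /(cvgr_gt _ ur); apply: filterS => d /ltW.
move=> _; exists (a + 1); first by lra.
move/cvgeyPgt : ug => /(_ (a + 1)).
by apply: filterS => d; rewrite lte_fin => /ltW.
Qed.

Lemma continuous_gauss_cdf (R : realType) : continuous (@gauss_cdf R).
Proof.
move=> x; apply: differentiable_continuous; apply/derivable1_diffP.
by have [] := is_derive_gauss_cdf x.
Qed.

Lemma natr_root_cvgy (R : realType) (p : nat) :
  d%:R `^ p.+1%:R^-1 @[d --> \oo] --> (+oo : set_system R).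
Proof.
apply/cvgryPge => A; near=> d; apply: le_trans (ler_norm A) _.
rewrite -(@ler_pXn2r _ p.+1) ?nnegrE ?powR_ge0 //.
rewrite -powR_mulrn ?powR_ge0 // -[X in _ <= X]powR_mulrn ?powR_ge0 //.
rewrite -powRrM mulVf ?pnatr_eq0 // powRr1 // powR_mulrn //.
by near: d; exact: nbhs_infty_ger.
Unshelve. all: by end_near. Qed.

(** Mean and variance are both [d + c sqrt d + o(sqrt d)], so the standardized threshold
    [(d - mean) / sqrt variance] tends to [- c]; the smoothing bounds squeeze the probability. *)
Lemma below_prob_cvg_gauss (R : realType) (n : nat -> nat) (k : nat) (c : R)
    (r : nat -> R) :
  (forall d : nat, (0 < d)%N -> (d <= n d)%N) ->
  (forall e : R, 0 < e -> \forall d \near \oo, `|r d| <= e * Num.sqrt d%:R) ->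
  (forall d : nat,
    (k%:R + 2^-1) * ln (n d)%:R = d%:R + c * Num.sqrt d%:R + r d) ->
  below_prob R k (n d) d @[d --> \oo] --> gauss_cdf (- c).
Proof.
move=> n_ge r_small Lr; have [C mom] := step_probs_moments R k.
(* With [d = t ^+ 14] and smoothing variance [tau = t ^+ 10], the Lindeberg error
   [V / tau ^ (3/2)] is of order [1 / t], and so is the shift [t ^+ 6] of the
   threshold relative to the standard deviation, which is of order [t ^+ 7]. *)
pose t (d : nat) : R := d%:R `^ 14%:R^-1.
pose m d := \sum_(p <- step_probs R k (n d)) p.
pose V d := \sum_(p <- step_probs R k (n d)) p * (1 - p).
pose L d := (k%:R + 2^-1) * ln (n d)%:R : R.
have t14 d : t d ^+ 14 = d%:R.
  by rewrite -powR_mulrn ?powR_ge0 // -powRrM mulVf ?pnatr_eq0 // powRr1.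
have sqrt_d d : Num.sqrt d%:R = t d ^+ 7.
  by rewrite -t14 (exprM _ 7 2) sqrtr_sqr ger0_norm // exprn_ge0 // powR_ge0.
have ty : t d @[d --> \oo] --> +oo by exact: natr_root_cvgy.
have t1 : \forall d \near \oo, 1 <= t d by exact: cvgry_ge.
have it0 : (t d)^-1 @[d --> \oo] --> (0 : R).
  by apply/gtr0_cvgV0 => //; exact: cvgry_gt.
have itX i : (t d) ^- i.+1 @[d --> \oo] --> (0 : R).
  elim: i => [|i IHi]; first by apply: cvg_near_eq it0; exact: nearW.
  apply: (@cvg_near_eq _ _ (fun d => (t d)^-1 * (t d) ^- i.+1)).
    by apply: nearW => d; rewrite exprS invfM.
  by rewrite -(mulr0 (0 : R)); exact: cvgM.
have r0 : r d * (t d) ^- 7 @[d --> \oo] --> (0 : R).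
  apply/cvgr0Pnorm_le => e e0; have := r_small e e0.
  apply: filterS2 t1 => d td; rewrite sqrt_d => rd.
  have t7 : 0 < t d ^+ 7 by rewrite exprn_gt0 // (lt_le_trans ltr01).
  by rewrite normrM (ger0_norm (_ : 0 <= _^-1)) ?invr_ge0 ?(ltW t7) // ler_pdivrMr.
have kn : \forall d \near \oo, (k < n d)%N.
  near=> d; apply: leq_trans (n_ge d _); last by near: d; exact: nbhs_infty_gt.
  by near: d; exact: nbhs_infty_gt.
have mB i : (m d - L d) * (t d) ^- i.+1 @[d --> \oo] --> (0 : R).
  apply: (@cvg0_bounded_mul _ _ _ C _ (itX i)).
  by apply: filterS kn => d /mom[].
have VB i : (V d - L d) * (t d) ^- i.+1 @[d --> \oo] --> (0 : R).
  apply: (@cvg0_bounded_mul _ _ _ C _ (itX i)).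
  by apply: filterS kn => d /mom[].
have Vd : V d * (t d) ^- 14 @[d --> \oo] --> (1 : R).
  apply: (@cvg_near_eq _ _ (fun d => 1 + c * (t d) ^- 7
    + (r d * (t d) ^- 7) * (t d) ^- 7 + (V d - L d) * (t d) ^- 14)).
    apply: filterS t1 => d td.
    have td0 : t d != 0 by rewrite gt_eqF // (lt_le_trans ltr01).
    by rewrite /L Lr sqrt_d -t14; field.
  rewrite -[X in _ --> X](_ : 1 + c * 0 + 0 * 0 + 0 = 1 :> R); last by ring.
  apply: cvgD => //; apply: cvgD; last exact: cvgM.
  by apply: cvgD; [exact: cvg_cst|apply: cvgM => //; exact: cvg_cst].
have den : Num.sqrt ((t d) ^- 4 + V d * (t d) ^- 14) @[d --> \oo] --> (1 : R).
  rewrite -[X in _ --> X]sqrtr1 -[X in _ --> Num.sqrt X]add0r.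
  apply: (continuous_cvg _ (@sqrt_continuous R _)).
  exact: cvgD.
(* Numerator and denominator are divided by [t^7], that is by [sqrt d]; [b = 1] and [b = -1] are the
   two threshold shifts. *)
have lim (b : R) : gauss_cdf ((d%:R + b * t d ^+ 6 - m d)
    / Num.sqrt (t d ^+ 10 + V d)) @[d --> \oo] --> gauss_cdf (- c).
  apply: (continuous_cvg _ (@continuous_gauss_cdf R _)).
  apply: (@cvg_near_eq _ _ (fun d => (- c - r d * (t d) ^- 7
    - (m d - L d) * (t d) ^- 7 + b * (t d)^-1)
    * (Num.sqrt ((t d) ^- 4 + V d * (t d) ^- 14))^-1)).
    apply: filterS t1 => d td; have td0 : 0 < t d by rewrite (lt_le_trans ltr01).
    have tn0 : t d != 0 by rewrite gt_eqF.
    have V0 : 0 <= V d.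
      rewrite /V big_seq; apply: sumr_ge0 => q /step_probs01 /andP[q0 q1].
      by rewrite mulr_ge0 // subr_ge0.
    have -> : (t d) ^- 4 + V d * (t d) ^- 14 = (t d ^+ 10 + V d) * ((t d) ^- 7) ^+ 2.
      by field.
    rewrite sqrtrM; last by rewrite addr_ge0 // exprn_ge0 // ltW.
    rewrite sqrtr_sqr ger0_norm; last by rewrite invr_ge0 exprn_ge0 // ltW.
    have : Num.sqrt (t d ^+ 10 + V d) != 0.
      by rewrite gt_eqF // sqrtr_gt0 ltr_pwDl // exprn_gt0.
    rewrite /L Lr sqrt_d -t14; move: (Num.sqrt _) => z z0.
    by field; rewrite z0 tn0.
  rewrite -[X in _ --> X](_ : (- c - 0 - 0 + b * 0) * 1^-1 = - c :> R); last first.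
    by rewrite invr1; ring.
  apply: cvgM; last by apply: cvgV => //; exact: oner_neq0.
  apply: cvgD; last by apply: cvgM => //; exact: cvg_cst.
  apply: cvgB; last exact: mB.
  by apply: cvgB => //; exact: cvg_cst.
have err : 8 * V d / t d ^+ 15 @[d --> \oo] --> (0 : R).
  apply: (@cvg_near_eq _ _ (fun d => 8 * (V d * (t d) ^- 14) * (t d)^-1)).
    apply: filterS t1 => d td.
    have td0 : t d != 0 by rewrite gt_eqF // (lt_le_trans ltr01).
    by field.
  rewrite -[X in _ --> X](_ : 8 * 1 * 0 = 0 :> R); last by rewrite mulr0.
  by apply: cvgM => //; apply: cvgM => //; exact: cvg_cst.
apply: (@squeeze_cvgr _ _ _ _
  (fun d => gauss_cdf ((d%:R - 1 * t d ^+ 6 - m d) / Num.sqrt (t d ^+ 10 + V d))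
    - 8 * V d / t d ^+ 15 - gauss_cdf (- t d))
  (fun d => gauss_cdf ((d%:R + 1 * t d ^+ 6 - m d) / Num.sqrt (t d ^+ 10 + V d))
    + 8 * V d / t d ^+ 15 + (1 - gauss_cdf (t d)))).
- apply: filterS t1 => d td; rewrite !mul1r; apply/andP; split.
    by apply: bernoulli_below_ge => //; exact: step_probs01.
  by apply: bernoulli_below_le => //; exact: step_probs01.
- rewrite -[X in _ --> X](_ : gauss_cdf (- c) - 0 - 0 = _); last by rewrite !subr0.
  apply: cvgB; last first.
    apply: (cvg_comp _ _ _ (@gauss_cdf_cvgNy R)).
    by apply/cvgNrNy; exact: ty.
  apply: cvgB => //; apply: cvg_near_eq (lim (-1)).
  by apply: nearW => d; rewrite mulNr.
- rewrite -[X in _ --> X](_ : gauss_cdf (- c) + 0 + (1 - 1) = _); last first.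
    by rewrite subrr !addr0.
  apply: cvgD; first by apply: cvgD => //; exact: lim.
  apply: cvgB; first exact: cvg_cst.
  exact: (cvg_comp _ _ ty (@gauss_cdf_cvgy R)).
Unshelve. all: by end_near. Qed.

(** * The phase transition for expected face numbers *)

Theorem theorem4p1 (R : realType) (formula : expected_faces_formula R)
    (n : nat -> nat) (n_ge : forall d : nat, (0 < d)%N -> (d <= n d)%N)
    (disp : nat -> measure_display)
    (Omega : forall d : nat, measurableType (disp d))
    (P : forall d : nat, probability (Omega d) R)
    (xi : forall d : nat, 'I_(n d) -> {RV (P d) >-> d.-tuple R})
    (xi_steps : forall d : nat, (0 < d)%N -> walk_steps (xi d))
    (gamma : \bar R)
    (gamma_lim :
       (ln ((n d)%:R : R) / d%:R)%:E @[d --> \oo] --> gamma)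
    (k : nat) :
  [/\ (gamma < ((k%:R + 2^-1)^-1)%:E)%E ->
        (expected_faces (xi d) k / ('C(n d, k)%:R)%:E)%E @[d --> \oo] --> 1%E,
      (((k%:R + 2^-1)^-1)%:E < gamma)%E ->
        (expected_faces (xi d) k / ('C(n d, k)%:R)%:E)%E @[d --> \oo] --> 0%E
    & gamma = ((k%:R + 2^-1)^-1)%:E ->
      forall (c : R) (r : nat -> R),
        r =o_\oo (fun d : nat => Num.sqrt (d%:R : R)) ->
        (forall d : nat,
           ln ((n d)%:R : R) =
           (k%:R + 2^-1)^-1 * (d%:R + c * Num.sqrt d%:R + r d)) ->
        (expected_faces (xi d) k / ('C(n d, k)%:R)%:E)%E @[d --> \oo] -->
          (((Num.sqrt (2 * pi))^-1)%:E *
            \int[lebesgue_measure]_(x in `]-oo, (- c)%R])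
               (expR (- (x ^+ 2) / 2)%R)%:E)%E].
Proof.
have kappa0 : 0 < k%:R + 2^-1 :> R by rewrite ltr_pwDr // invr_gt0.
(* All three claims reduce to the limit of [below_prob]; the given formula applies as soon as
   [d > k]. *)
have ratio L : below_prob R k (n d) d @[d --> \oo] --> L ->
    (expected_faces (xi d) k / ('C(n d, k)%:R)%:E)%E @[d --> \oo] --> L%:E.
  move=> bL; have frac := face_ratio_cvg n_ge bL.
  apply: (@cvg_near_eq _ _ (fun d => ((\sum_(j < k.+1) (-1) ^+ (k - j) *+ 'C(k, j)
    * 'C(n d + j, j)%:R * below_prob R j (n d) d) / 'C(n d, k)%:R)%:E)); last first.
    by apply/fine_cvgP; split; [exact: nearW|exact: frac].
  near=> d.
  have kd : (k < d)%N by near: d; exact: nbhs_infty_gt.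
  have d0 : (0 < d)%N by exact: leq_ltn_trans kd.
  have kn : (k < n d)%N by exact: leq_trans kd (n_ge d d0).
  rewrite (formula _ _ _ _ _ _ _ (n_ge d d0) kd (xi_steps d d0)).
  rewrite expected_faces_below // inver ifF ?EFinM //.
  (* The inverse in the extended reals treats 0 separately; [k < n d] keeps the binomial coefficient
     away from it. *)
  by apply/negbTE; rewrite pnatr_eq0 -lt0n bin_gt0 ltnW.
split.
- move=> /(ereal_cvg_lt gamma_lim)[b bk ub].
  apply/ratio/(@below_prob_cvg1 _ _ _ ((k%:R + 2^-1) * b)) => //.
    by rewrite -ltr_pdivlMl // mulr1.
  near=> d; rewrite -mulrA ler_pM2l // -ler_pdivrMr; first by near: d.
  by near: d; exact: nbhs_infty_gtr.
- move=> /(ereal_cvg_gt gamma_lim)[b kb ub].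
  apply/ratio/(@below_prob_cvg0 _ _ _ ((k%:R + 2^-1) * b)) => //.
    by rewrite -ltr_pdivrMl // mulr1.
  near=> d; rewrite -mulrA ler_pM2l // -ler_pdivlMr; first by near: d.
  by near: d; exact: nbhs_infty_gtr.
move=> _ c r /eqoP ro Lr; rewrite -gauss_cdfE; apply: ratio.
apply: (@below_prob_cvg_gauss _ _ _ c r) => // [e e0|d].
  have := ro e e0; apply: filterS => d /=.
  by rewrite (ger0_norm (sqrtr_ge0 _)).
by rewrite Lr mulrA divff ?mul1r // gt_eqF.
Unshelve. all: by end_near. Qed.
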